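(* Let $d\geq 1$ and $N\geq 0$ be integers. There exist: (i) a radial, nonnegative real potential $V$ on $\mathbb{R}^d$, with compact support, such that $V\in C^\infty(\mathbb{R}^d\setminus\{0\})$ and, for some constants $C>0$ and $r_0>0$, $$\frac{|\log r|^2}{C r^2}\leq V(r)\leq \frac{C|\log r|^2}{r^2},\qquad 0<r\leq r_0;$$ (ii) an increasing sequence $(\lambda_n)_{n\geq n_0}$ of positive real numbers, diverging to $+\infty$; (iii) a sequence of radial $C^\infty$ functions $(u_n)_{n\geq n_0}$ on $\mathbb{R}^d$, whose supports are of the form $$\left\{ x\in\mathbb{R}^d:\ c_1\frac{\log\lambda_n}{\lambda_n}\leq r\leq c_2\frac{\log\lambda_n}{\lambda_n}\right\}$$ with constants $0<c_1<c_2$ independent of $n$; such that, defining $f_n$ by $$(-\Delta+V)u_n-\lambda_n^2u_n=f_n,$$ one has $$\|u_n\|_{L^1(\mathbb{R}^d)}=1\quad\text{for all } n\geq n_0,$$ and $$\forall j\in\mathbb{N},\qquad \left\|\frac{d^j}{dr^j}f_n\right\|_{L^\infty}=O\big(\lambda_n^{j-N}\big),\qquad n\to+\infty.$$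
   Context: Here $\Delta=\sum_{j=1}^d \partial^2/\partial x_j^2$ and $r=|x|$ is the Euclidean norm of $x\in\mathbb{R}^d$. Radial functions are identified with functions of $r$, and $\frac{d}{dr}$ is the radial derivative. $\mathbb{N}$ denotes the nonnegative integers. For $d=1$, radial means even. *)

(* Defs.v *)
From HB Require Import structures.
From mathcomp Require Import all_boot all_order all_algebra.
From mathcomp Require Import all_classical all_reals all_analysis.

Set Implicit Arguments.
Unset Strict Implicit.
Unset Printing Implicit Defensive.
Import Order.TTheory GRing.Theory Num.Theory.
Import numFieldNormedType.Exports.

Local Open Scope classical_set_scope.
Local Open Scope ring_scope.

Section lebesgue_measure_Rn.
Context {R : realType}.
Local Notation mR := (measurableTypeR R).

Definition consT n (p : mR * n.-tuple mR) : n.+1.-tuple mR :=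
  [tuple of p.1 :: p.2].

Definition unconsT n (t : n.+1.-tuple mR) : mR * n.-tuple mR :=
  (thead t, [tuple of behead t]).

Lemma consTK n : cancel (@consT n) (@unconsT n).
Proof.
move=> [x t]; rewrite /unconsT /consT theadE; congr pair.
exact/val_inj.
Qed.

Lemma measurable_consT n : measurable_fun [set: mR * n.-tuple mR] (@consT n).
Proof. exact: measurable_cons measurable_fst measurable_snd. Qed.

Lemma measurable_unconsT n :
  measurable_fun [set: n.+1.-tuple mR] (@unconsT n).
Proof.
apply/measurable_fun_pairP; split; first exact: measurable_tnth.
exact: measurable_behead.
Qed.

Section next_measure.
Variables (n : nat) (m : {sigma_finite_measure set (n.-tuple mR) -> \bar R}).

Definition next_measure : set (n.+1.-tuple mR) -> \bar R :=
  pushforward (lebesgue_measure \x m)%E (@consT n).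

Let measurable_pre A : measurable A -> measurable (@consT n @^-1` A).
Proof. by rewrite -[X in _ -> measurable X]setTI; exact: measurable_consT. Qed.

Let next_measure0 : next_measure set0 = 0%E.
Proof. by rewrite /next_measure /pushforward preimage_set0 measure0. Qed.

Let next_measure_ge0 A : (0 <= next_measure A)%E.
Proof. by rewrite /next_measure /pushforward; exact: measure_ge0. Qed.

Let next_measure_sigma_additive : semi_sigma_additive next_measure.
Proof.
move=> F mF tF mUF; rewrite /next_measure /pushforward preimage_bigcup.
apply: measure_semi_sigma_additive.
- by move=> i; exact: measurable_pre.
- apply/trivIsetP => /= i j _ _ ij; rewrite -preimage_setI.
  by move/trivIsetP : tF => /(_ _ _ _ _ ij) ->//; rewrite preimage_set0.
- by rewrite -preimage_bigcup; exact: measurable_pre.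
Qed.

HB.instance Definition _ := isMeasure.Build _ _ _ next_measure
  next_measure0 next_measure_ge0 next_measure_sigma_additive.

Lemma next_measure_sigma_finite : sigma_finite setT next_measure.
Proof.
have /sigma_finiteP[F [TF ndF Foo]] := sigma_finiteT (@lebesgue_measure R).
have /sigma_finiteP[G [TG ndG Goo]] := sigma_finiteT m.
exists (fun i => @unconsT n @^-1` (F i `*` G i)).
  rewrite -preimage_bigcup (_ : \bigcup_i _ = setT) ?preimage_setT//.
  rewrite -subTset => -[x y] _.
  have [k _ Fkx] : (\bigcup_i F i) x by rewrite -TF.
  have [l _ Gly] : (\bigcup_i G i) y by rewrite -TG.
  exists (maxn k l) => //; split.
  - by move: x Fkx; exact/subsetPset/ndF/leq_maxl.
  - by move: y Gly; exact/subsetPset/ndG/leq_maxr.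
move=> i; have [mF Fioo] := Foo i; have [mG Gioo] := Goo i; split.
  rewrite -[X in measurable X]setTI; apply: measurable_unconsT => //.
  exact: measurableX.
rewrite /next_measure /pushforward -comp_preimage.
rewrite (_ : _ \o _ = id); last by apply/funext => p /=; rewrite consTK.
by rewrite preimage_id product_measure1E// lte_mul_pinfty// ge0_fin_numE.
Qed.

HB.instance Definition _ :=
  Measure_isSigmaFinite.Build _ _ _ next_measure next_measure_sigma_finite.

End next_measure.

(* The library has no Lebesgue measure in dimension n; it is built here as the
   n-fold product measure, starting from the unit mass on the point R^0. *)
Fixpoint lebesgueRn n : {sigma_finite_measure set (n.-tuple mR) -> \bar R} :=
  match n with
  | 0 => dirac [tuple]
  | n'.+1 => next_measure (lebesgueRn n')
  end.

(* The defining property of Lebesgue measure on R^n: the measure of a box is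
   the product of the measures of its sides. *)
Lemma lebesgueRn_box n (A : 'I_n -> set mR) :
  (forall i, measurable (A i)) ->
  lebesgueRn n [set t | forall i, A i (tnth t i)] =
  (\prod_(i < n) lebesgue_measure (A i))%E.
Proof.
elim: n A => [|n IH] A mA /=.
  by rewrite big_ord0 diracE mem_set// => -[].
have mB : measurable
    [set t : n.-tuple mR | forall i, A (lift ord0 i) (tnth t i)].
  rewrite (_ : [set _ | _] = \bigcap_(i in [set: 'I_n])
      (fun t => tnth t i) @^-1` A (lift ord0 i)).
    apply: fin_bigcap_measurable => // i _.
    by rewrite -[X in measurable X]setTI; exact: measurable_tnth.
  by apply/seteqP; split=> t /= h i => [_|]; exact: h.
rewrite big_ord_recl /= -IH; last by move=> i; exact: mA.
rewrite -product_measure1E//= /next_measure /pushforward.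
congr product_measure1; apply/seteqP; split=> -[x t] /=.
  move=> h; split; first by have := h ord0.
  by move=> i; have := h (lift ord0 i); rewrite tnthS.
move=> [h0 h] i; case: (unliftP ord0 i) => [j ->|->//]; rewrite tnthS; exact: h.
Qed.

End lebesgue_measure_Rn.

Section euclidean_space.
Context {R : realType} {d : nat}.
Implicit Types (f : 'rV[R]_d -> R) (x : 'rV[R]_d).

(* The library norm on row vectors is the sup norm, hence a separate Euclidean
   norm; both induce the topology carried by 'rV[R]_d. *)
Definition enorm x : R := Num.sqrt (\sum_(i < d) x 0 i ^+ 2).

Definition radial f := forall x y, enorm x = enorm y -> f x = f y.

Definition dpart (i : 'I_d) f : 'rV[R]_d -> R := 'D_(delta_mx 0 i) f.

Definition dparts (s : seq 'I_d) f : 'rV[R]_d -> R := foldr dpart f s.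

(* C^oo on U: the iterated partial derivatives of all orders exist and are
   continuous at every point of U.  Meant for open U only. *)
Definition smooth_on (U : set 'rV[R]_d) f := forall (s : seq 'I_d) x, U x ->
  {for x, continuous (dparts s f)} /\
  forall i, derivable (dparts s f) x (delta_mx 0 i).

Definition laplacian f x : R := \sum_(i < d) dpart i (dpart i f) x.

(* d/dr on R^d \ {0}: the derivative in the direction x / |x|. At the origin,
   a null set, the direction degenerates to 0 and the value is 0. *)
Definition radial_deriv f x : R := 'D_((enorm x)^-1 *: x) f x.

Definition tsupport f : set 'rV[R]_d := closure [set x | f x != 0].

Definition normL (p : \bar R) f : \bar R :=
  Lnorm (lebesgueRn d) p (fun t => (f (\row_i tnth t i))%:E).

End euclidean_space.

(* Main.v *)
(* The potential is built from the quasimodes.  Put L_n = ln lambda_n and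
   rho_n = L_n / lambda_n.  The Gaussian u = exp (- L_n a (|x|^2/rho_n^2 - 1)^2)
   solves - Delta u + V u = lambda_n^2 u exactly for V = lambda_n^2 + Delta u / u,
   and for L_n large this V is comparable to lambda_n^2, that is to
   |ln r|^2 / r^2, on the annulus r ~ rho_n.  With lambda_n = exp (M (n + 1)) and
   M large these annuli are disjoint, so a single potential can contain all the
   wells.  Cutting u off where |(|x|^2/rho_n^2) - 1| >= 1/2 produces an error
   O(lambda_n^(j + 2 - a/4)) in the j-th derivative, while normalizing u in L^1
   costs at most lambda_n^(d + a/16); a = 16 (N + d + 2) is then enough. *)
Require Import Defs.
From mathcomp Require Import all_boot all_order all_algebra.
From mathcomp Require Import all_classical all_reals all_analysis.
From mathcomp Require Import measurable_realfun ess_sup_inf ring lra zify.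
Import Order.TTheory GRing.Theory Num.Theory.
Import numFieldNormedType.Exports.
Local Open Scope classical_set_scope.
Local Open Scope ring_scope.

Set Implicit Arguments.
Unset Strict Implicit.
Unset Printing Implicit Defensive.

(** * Iterated derivatives *)

(** For [u = exp (- L psi(q))] with [q = |x|^2 / rho^2], the quotient [Delta u / u] is [rho^-2 (4 q
    (L^2 psi'^2 - L psi'') - 2 d L psi')]. Since [rho^-2 L^2 = lambda^2], the term [4 q psi'^2] is
    nonnegative and enters at the size of the energy, while the two others are [O(lambda^2 / L)];
    this is why large [L] keeps the potential positive. Thus [1 / L] acts as a semiclassical
    parameter, and as [L] is only logarithmic in [lambda], the tunnelling factor [exp (- c L)] is
    the power [lambda^-c]: any [N] is reachable, by making the well steep. Between the wells the
    potential is [|ln r|^2 / r^2] itself. Gluing is a convex combination of two comparable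
    functions, so the two-sided bound survives it. Two radial variables coexist. Functions of
    [|x|^2] are smooth across the origin for free, so the quasimodes are built on [q]. The
    derivatives [d/dr] live on [|x|], which is not smooth at 0; the error is therefore also written
    as a function of [s = |x| / rho], depending on [s^2] only and defined on the whole line, and all
    its estimates are one-dimensional and uniform in [L]. *)

Section iterated_derivatives.
Context {R : realType} {W : normedModType R} {I : Type} (dir : I -> W).
Implicit Types (f g : W -> R) (U : set W) (k : nat).

(* The directions are a parameter so that one set of closure lemmas covers
   both functions on R (the direction 1) and functions on R^d. *)
Fixpoint Ck k U f : Prop :=
  (forall x, U x -> {for x, continuous f}) /\
  if k is k'.+1 then
    forall i, (forall x, U x -> derivable f x (dir i)) /\ Ck k' U ('D_(dir i) f)
  else True.

Definition Cinf U f := forall k, Ck k U f.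

Lemma Ck_continuous k U f : Ck k U f -> forall x, U x -> {for x, continuous f}.
Proof. by case: k => [|k] []. Qed.

Lemma CkW k U f : Ck k.+1 U f -> Ck k U f.
Proof.
elim: k f => [|k IH] f [cf df]; first by split.
by split=> // i; have [? ?] := df i; split=> //; exact: IH.
Qed.

Lemma Ck_subset k U U' f : U' `<=` U -> Ck k U f -> Ck k U' f.
Proof.
move=> sU; elim: k f => [|k IH] f [cf df]; split=> //.
- by move=> x /sU /cf.
- by move=> x /sU /cf.
- by move=> i; have [d1 d2] := df i; split; [move=> x /sU /d1|exact: IH].
Qed.

Lemma eq_Ck k U f g : open U -> (forall x, U x -> f x = g x) ->
  Ck k U f -> Ck k U g.
Proof.
move=> oU; elim: k f g => [|k IH] f g fg [cf df].
  split=> // x Ux; have nfg : \forall y \near x, f y = g y.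
    by apply: filterS (open_nbhs_nbhs (conj oU Ux)) => y /fg.
  by rewrite /prop_for /continuous_at -(fg _ Ux); apply: cvg_trans (cf _ Ux);
     exact: near_eq_cvg.
have nfg x : U x -> \forall y \near x, f y = g y.
  by move=> Ux; apply: filterS (open_nbhs_nbhs (conj oU Ux)) => y /fg.
split=> [x Ux|i].
  rewrite /prop_for /continuous_at -(fg _ Ux); apply: cvg_trans (cf _ Ux).
  by apply: near_eq_cvg; exact: nfg.
have [d1 d2] := df i; split=> [x Ux|].
  by apply: near_eq_derivable (d1 _ Ux); exact: nfg.
by apply: IH d2 => x Ux; apply: near_eq_derive; exact: nfg.
Qed.

Lemma Ck_cst k U (c : R) : Ck k U (fun=> c).
Proof.
elim: k c => [|k IH] c.
  by split=> // x _; exact: cvg_cst.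
split=> [x _|i]; first exact: cvg_cst.
split=> [x _|]; first exact: derivable_cst.
suff -> : 'D_(dir i) (fun=> c) = fun=> (0 : R) by exact: IH.
by apply/funext => x; exact: derive_cst.
Qed.

Lemma CkD k U f g : open U -> Ck k U f -> Ck k U g -> Ck k U (f \+ g).
Proof.
move=> oU; elim: k f g => [|k IH] f g [cf df] [cg dg].
  by split=> // x Ux; apply: cvgD; [exact: cf|exact: cg].
split=> [x Ux|i]; first by apply: cvgD; [exact: cf|exact: cg].
have [df1 df2] := df i; have [dg1 dg2] := dg i.
split=> [x Ux|]; first by apply: derivableD; [exact: df1|exact: dg1].
apply: eq_Ck (IH _ _ df2 dg2) => // x Ux; apply/esym.
by apply: deriveD; [exact: df1|exact: dg1].
Qed.

Lemma CkM k U f g : open U -> Ck k U f -> Ck k U g -> Ck k U (f \* g).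
Proof.
move=> oU; elim: k f g => [|k IH] f g Cf Cg.
  split=> // x Ux; apply: cvgM; [exact: (Ck_continuous Cf Ux)|].
  exact: (Ck_continuous Cg Ux).
split=> [x Ux|i].
  apply: cvgM; [exact: (Ck_continuous Cf Ux)|exact: (Ck_continuous Cg Ux)].
have [_ /(_ i) [df1 df2]] := Cf; have [_ /(_ i) [dg1 dg2]] := Cg.
split=> [x Ux|]; first by apply: derivableM; [exact: df1|exact: dg1].
have H := CkD oU (IH _ _ (CkW Cf) dg2) (IH _ _ (CkW Cg) df2).
apply: eq_Ck H => // x Ux; apply/esym.
by apply: deriveM; [exact: df1|exact: dg1].
Qed.

Lemma Cinf_continuous U f : Cinf U f -> forall x, U x -> {for x, continuous f}.
Proof. by move=> /(_ 0)/Ck_continuous. Qed.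

Lemma Cinf_derivable U f i : Cinf U f -> forall x, U x -> derivable f x (dir i).
Proof. by move=> /(_ 1%N) [_ /(_ i)[]]. Qed.

Lemma Cinf_derive U f i : Cinf U f -> Cinf U ('D_(dir i) f).
Proof. by move=> Cf k; have [_ /(_ i)[]] := Cf k.+1. Qed.

Lemma Cinf_subset U U' f : U' `<=` U -> Cinf U f -> Cinf U' f.
Proof. by move=> sU Cf k; exact: Ck_subset (Cf k). Qed.

Lemma eq_Cinf U f g : open U -> (forall x, U x -> f x = g x) ->
  Cinf U f -> Cinf U g.
Proof. by move=> oU fg Cf k; exact: eq_Ck (Cf k). Qed.

Lemma Cinf_cst U (c : R) : Cinf U (fun=> c).
Proof. by move=> k; exact: Ck_cst. Qed.

Lemma CinfD U f g : open U -> Cinf U f -> Cinf U g -> Cinf U (f \+ g).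
Proof. by move=> oU Cf Cg k; exact: CkD. Qed.

Lemma CinfM U f g : open U -> Cinf U f -> Cinf U g -> Cinf U (f \* g).
Proof. by move=> oU Cf Cg k; exact: CkM. Qed.

Lemma CinfN U f : open U -> Cinf U f -> Cinf U (fun x => - f x).
Proof.
move=> oU /(CinfM oU (Cinf_cst U (-1))); apply: eq_Cinf => // x _ /=.
by rewrite mulN1r.
Qed.

Lemma CinfB U f g : open U -> Cinf U f -> Cinf U g ->
  Cinf U (fun x => f x - g x).
Proof. by move=> oU Cf /(CinfN oU) Cg; exact: CinfD. Qed.

Lemma CinfX U f n : open U -> Cinf U f -> Cinf U (fun x => f x ^+ n).
Proof.
move=> oU Cf; elim: n => [|n IH].
  by apply: eq_Cinf (Cinf_cst U 1) => // x _; rewrite expr0.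
by apply: eq_Cinf (CinfM oU Cf IH) => // x _; rewrite exprS.
Qed.

Lemma Cinf_sum U n (F : 'I_n -> W -> R) : open U -> (forall i, Cinf U (F i)) ->
  Cinf U (fun x => \sum_(i < n) F i x).
Proof.
move=> oU; elim: n F => [|n IH] F CF.
  by apply: eq_Cinf (Cinf_cst U 0) => // x _; rewrite big_ord0.
have := CinfD oU (CF ord0) (IH (fun i => F (lift ord0 i)) (fun i => CF _)).
by apply: eq_Cinf => // x _; rewrite big_ord_recl.
Qed.

(** Meant for the potential, which is a finite sum of smooth terms only locally. *)
Lemma Cinf_local U f :
  (forall x, U x -> exists U', [/\ open U', U' x & Cinf U' f]) -> Cinf U f.
Proof.
move=> H k; elim: k f H => [|k IH] f H.
  by split=> // x /H [U' [_ U'x /Cinf_continuous]]; apply.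
split=> [x /H [U' [_ U'x /Cinf_continuous]]|i]; first exact.
split=> [x /H [U' [_ U'x /Cinf_derivable]]|]; first exact.
apply: IH => x /H [U' [? ? Cf]]; exists U'; split=> //.
exact: Cinf_derive.
Qed.

End iterated_derivatives.

(** * Smooth functions of one variable and the chain rule *)

Section smooth_on_line.
Context {R : realType}.

Definition Csm (D : set R) (F : R -> R) := Cinf (fun _ : unit => (1 : R)) D F.

Lemma is_derive_compR (F G : R -> R) (t : R) :
  derivable G t 1 -> derivable F (G t) 1 ->
  is_derive t 1 (F \o G) ('D_1 F (G t) * 'D_1 G t).
Proof.
move=> dG dF; split; last first.
  rewrite -(derive1E (F \o G) t) -(derive1E F (G t)) -(derive1E G t).
  exact: (@derive1_comp R G F t dG dF).
apply/derivable1_diffP/differentiable_comp.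
  exact: (proj1 (derivable1_diffP G t) dG).
exact: (proj1 (derivable1_diffP F (G t)) dF).
Qed.

Lemma deriveE1 (W : normedModType R) (g : W -> R) (x v : W) :
  'D_v g x = derive1 (fun h : R => g (h *: v + x)) 0.
Proof.
rewrite /derive /derive1; set F1 := fun h => _; set F2 := fun h => _.
suff -> : F1 = F2 by [].
by apply/funext => h; rewrite /F1 /F2 /= addr0 scale0r add0r.
Qed.

(** Only the derivative of [g] along [v] is assumed, not differentiability, so the problem is
    restricted to the line [h *: v + x], where the scalar chain rule applies. *)
Lemma derive_compR (W : normedModType R) (F : R -> R) (g : W -> R) (x v : W) :
  derivable g x v -> derivable F (g x) 1 ->
  is_derive x v (F \o g) ('D_1 F (g x) * 'D_v g x).
Proof.
move=> dgx dF; have G0 : g (0 *: v + x) = g x by rewrite scale0r add0r.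
have := @is_derive_compR F (fun h : R => g (h *: v + x)) 0
  (proj1 (derivable1P g x v) dgx).
rewrite {}G0 => /(_ dF) [d1 d2].
split; first exact: (proj2 (derivable1P (F \o g) x v) d1).
by rewrite (deriveE1 (F \o g)) (deriveE1 g) [LHS]derive1E (derive1E _ 0) -d2.
Qed.

Lemma is_derive_comp (W : normedModType R) (F : R -> R) (g : W -> R) (x v : W)
    (dF dg : R) : is_derive x v g dg -> is_derive (g x) 1 F dF ->
  is_derive x v (F \o g) (dF * dg).
Proof. by move=> [d1 <-] [d2 <-]; exact: derive_compR. Qed.

Lemma derivable_continuous (F : R -> R) x :
  derivable F x 1 -> {for x, continuous F}.
Proof. by move=> /derivable1_diffP/differentiable_continuous. Qed.

Lemma Ck_comp (W : normedModType R) I (dir : I -> W) (U : set W) (D : set R)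
    (F : R -> R) (g : W -> R) k : open U -> (forall x, U x -> D (g x)) ->
  Csm D F -> Cinf dir U g -> Ck dir k U (F \o g).
Proof.
move=> oU UD + Cg; elim: k F => [|k IH] F CF.
  split=> // x Ux; apply: continuous_comp; first exact: Cinf_continuous Cg _ Ux.
  exact: (Cinf_continuous CF (UD _ Ux)).
split=> [x Ux|i].
  apply: continuous_comp; first exact: Cinf_continuous Cg _ Ux.
  exact: (Cinf_continuous CF (UD _ Ux)).
have H x : U x -> is_derive x (dir i) (F \o g) ('D_1 F (g x) * 'D_(dir i) g x).
  move=> Ux; apply: derive_compR; first exact: Cinf_derivable Cg _ Ux.
  exact: (Cinf_derivable CF (UD _ Ux)).
split=> [x Ux|]; first by case: (H x Ux).
apply: eq_Ck (CkM oU (IH _ (Cinf_derive tt CF)) (Cinf_derive i Cg k)) => //.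
by move=> x /H [_ ->].
Qed.

Lemma Cinf_comp (W : normedModType R) I (dir : I -> W) (U : set W) (D : set R)
    (F : R -> R) (g : W -> R) : open U -> (forall x, U x -> D (g x)) ->
  Csm D F -> Cinf dir U g -> Cinf dir U (F \o g).
Proof. by move=> oU UD CF Cg k; exact: (Ck_comp k oU UD CF Cg). Qed.

(** A class of functions stable under differentiation consists of smooth functions. The class is a
    singleton for [expR] and a family indexed by polynomials for the flat function. *)
Lemma Csm_ind (D : set R) (P : (R -> R) -> Prop) : open D ->
  (forall F, P F -> exists2 G, P G & forall x, D x -> is_derive x 1 F (G x)) ->
  forall F, P F -> Csm D F.
Proof.
move=> oD H F PF k; elim: k F PF => [|k IH] F PF; have [G PG dF] := H _ PF.
  by split=> // x /dF [+ _] => /derivable_continuous.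
split=> [x /dF [+ _]|_]; first by move/derivable_continuous.
split=> [x /dF[]//|]; apply: eq_Ck (IH _ PG) => // x /dF [_]; exact: esym.
Qed.

Definition nderive j (g : R -> R) : R -> R := iter j (fun g => 'D_(1 : R) g) g.

Lemma nderiveS j g : nderive j.+1 g = 'D_(1 : R) (nderive j g).
Proof. by []. Qed.

Lemma nderiveSr j g : nderive j.+1 g = nderive j ('D_(1 : R) g).
Proof. by rewrite /nderive iterSr. Qed.

Lemma Csm_nderive D j g : Csm D g -> Csm D (nderive j g).
Proof. by move=> Cg; elim: j => // j IH; exact: (Cinf_derive tt IH). Qed.

Lemma Csm_derivable D g x : Csm D g -> D x -> derivable g x 1.
Proof. by move=> Cg Dx; exact: (Cinf_derivable (i := tt) Cg Dx). Qed.

Lemma Csm_id D : open D -> Csm D id.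
Proof.
move=> oD k; case: k => [|k]; first by split=> // x _; exact: cvg_id.
split=> [x _|_]; first exact: cvg_id.
split=> [x _|]; first exact: derivable_id.
by apply: eq_Ck (Ck_cst _ _ _ 1) => // x _; rewrite derive_id.
Qed.

Lemma Csm_expR D : open D -> Csm D expR.
Proof.
move=> oD; apply: (Csm_ind (P := fun F => F = expR)) => // F ->.
by exists expR => // x _; exact: is_derive_expR.
Qed.

Lemma is_derive_inv (x : R) : x != 0 ->
  is_derive x 1 (GRing.inv : R -> R) (- (x^-1 * x^-1)).
Proof.
move=> x0; have d0 : derivable (id : R -> R) x 1 by exact: derivable_id.
split; first exact: (@derivableV _ _ (id : R -> R) x 1 x0 d0).
rewrite (@deriveV _ _ (id : R -> R) x 1 x0 d0) derive_id.
by rewrite -exprVn [_ *: _]mulr1 expr2.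
Qed.

(** The derivative of the inverse is minus its own square, so regularity of order [k] yields order
    [k.+1] through the product rule. *)
Lemma Csm_inv : Csm [set x : R | x != 0] GRing.inv.
Proof.
have oD : open [set x : R | x != 0] by exact: open_neq.
have d (x : R) : [set x : R | x != 0] x -> _ := @is_derive_inv x.
elim=> [|k IH].
  by split=> // x /d [/derivable_continuous].
split=> [x /d [/derivable_continuous]//|_].
split=> [x /d[]//|].
have := CkM oD (Ck_cst _ k _ (-1)) (CkM oD IH IH).
by apply: eq_Ck => // x /d [_ ->]; rewrite /= mulN1r.
Qed.

Lemma Csm_ln : Csm [set x : R | 0 < x] (@ln R).
Proof.
have oD : open [set x : R | 0 < x] by exact: open_gt.
case=> [|k].
  by split=> // x x0; apply/derivable_continuous; case: (is_derive1_ln x0).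
split=> [x x0|_].
  by apply/derivable_continuous; case: (is_derive1_ln x0).
split=> [x x0|]; first by case: (is_derive1_ln x0).
have C : Csm [set x : R | 0 < x] GRing.inv.
  by apply: Cinf_subset Csm_inv => x /= /lt0r_neq0.
by apply: eq_Ck (C k) => // x x0; case: (is_derive1_ln x0).
Qed.

End smooth_on_line.

(** * Flat functions and cutoffs *)

Section flat_function.
Context {R : realType}.
Implicit Types (p : {poly R}) (x y : R).

(** Term by term: [y ^+ n <= n! * expR y] by the exponential series. *)
Lemma horner_le_expR p : exists2 C, 0 <= C & forall y, 0 <= y ->
  `|p.[y]| <= C * expR y.
Proof.
exists (\sum_(i < size p) `|p`_i| * i`!%:R).
  by apply: sumr_ge0 => i _; rewrite mulr_ge0.
move=> y y0; rewrite horner_coef; apply: le_trans (ler_norm_sum _ _ _) _.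
rewrite mulr_suml; apply: ler_sum => i _.
rewrite normrM -mulrA ler_wpM2l// normrX (ger0_norm y0).
case: (val i) => [|n].
  by rewrite expr0 fact0 mul1r (le_trans _ (expR_ge1Dx y))// lerDl.
have f0 : 0 < n.+1`!%:R :> R by rewrite ltr0n fact_gt0.
rewrite mulrC -ler_pdivrMr//; apply: le_trans (expR_ge1Dxn n y0).
by rewrite lerDr.
Qed.

(** Polynomial multiples of [exp (- 1 / x)], with the polynomial taken in [1 / x]: this family
    contains the flat function and is stable under differentiation, by [p |-> X^2 (p - p')]. *)
Definition flatp p x : R := if 0 < x then p.[x^-1] * expR (- x^-1) else 0.

(** Applied to ['X * p], whose function is the difference quotient of [flatp p] at 0, it shows that
    this quotient tends to 0. *)
Lemma flatp_le p : exists2 C, 0 <= C & forall x, `|flatp p x| <= C * `|x|.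
Proof.
have [C C0 HC] := horner_le_expR (p * 'X); exists C => // x.
rewrite /flatp; case: ifPn => [x0|_]; last by rewrite normr0 mulr_ge0.
have xV0 : 0 <= x^-1 by rewrite invr_ge0 ltW.
have := HC _ xV0; rewrite hornerM hornerX !normrM (ger0_norm xV0) => H.
rewrite (gtr0_norm x0) (gtr0_norm (expR_gt0 _)) expRN ler_pdivrMr ?expR_gt0//.
by rewrite mulrAC -ler_pdivrMr.
Qed.

Lemma flatpX p x : x^-1 * flatp p x = flatp ('X * p) x.
Proof.
by rewrite /flatp; case: ifPn => _; rewrite ?mulr0// mulrA hornerM hornerX.
Qed.

Lemma is_derive_flatp p x :
  is_derive x 1 (flatp p) (flatp ('X^2 * (p - p^`())) x).
Proof.
have [x0|x0|<-] := ltgtP 0 x.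
- have nx : x != 0 by rewrite gt_eqF.
  have near_x : \forall y \near x, p.[y^-1] * expR (- y^-1) = flatp p y.
    by near=> y; rewrite /flatp ifT//; near: y; exact: lt_nbhsr x0.
  apply: near_eq_is_derive near_x _.
  have di := is_derive_inv nx.
  have dp : is_derive x 1 (horner p \o GRing.inv)
      (p^`().[x^-1] * - (x^-1 * x^-1)).
    exact: is_derive_comp di (is_derive_poly p x^-1).
  have de : is_derive x 1 (expR \o (fun y => - y^-1))
      (expR (- x^-1) * (x^-1 * x^-1)).
    have d : is_derive x 1 (fun y : R => - y^-1) (x^-1 * x^-1).
      by rewrite -[X in is_derive _ _ _ X]opprK; exact: is_deriveN.
    exact: is_derive_comp d (is_derive_expR _).
  have [d1 d2] := is_deriveM dp de; split; first exact: d1.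
  rewrite [LHS]d2 /flatp x0 /= !hornerE /= /GRing.scale /=.
  by rewrite derivE; ring.
- have near_x : \forall y \near x, (fun=> 0) y = flatp p y.
    near=> y; rewrite /flatp ifF//; apply/negbTE; rewrite -leNgt ltW//.
    by near: y; exact: lt_nbhsl x0.
  apply: near_eq_is_derive near_x _.
  by rewrite /flatp ltNge (ltW x0) /=; exact: is_derive_cst.
- have f0 q : flatp q 0 = 0 by rewrite /flatp ltxx.
  rewrite f0; have [C C0 HC] := flatp_le ('X * p).
  have H : (fun h : R => h^-1 *: ((flatp p \o shift 0) (h *: 1) - flatp p 0))
      @ 0^' --> (0 : R).
    have C1 : 0 < C + 1 by rewrite ltr_wpDl.
    apply/cvgr0Pnorm_lt => e e0; near=> h.
    rewrite /= f0 subr0 addr0 [h *: 1]mulr1 [_ *: _]flatpX.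
    apply: le_lt_trans (HC _) _.
    apply: (@le_lt_trans _ _ ((C + 1) * `|h|)).
      by rewrite ler_wpM2r// lerDl.
    rewrite mulrC -ltr_pdivlMr//; near: h; apply: dnbhs0_lt.
    exact: divr_gt0.
  split; first by apply/cvg_ex; exists 0.
  exact: cvg_lim H.
Unshelve. all: by end_near. Qed.

Lemma Csm_flatp p : Csm setT (flatp p).
Proof.
apply: (Csm_ind (P := fun F => exists p, F = flatp p)) => [|F|].
- exact: openT.
- move=> [q ->]; exists (flatp ('X^2 * (q - q^`()))); first by eexists.
  by move=> x _; exact: is_derive_flatp.
- by exists p.
Qed.

Definition flat x : R := if 0 < x then expR (- x^-1) else 0.

Lemma Csm_flat : Csm setT flat.
Proof.
apply: eq_Cinf (Csm_flatp 1) => [|x _]; first exact: openT.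
by rewrite /flatp /flat hornerE mul1r.
Qed.

Lemma flat_ge0 x : 0 <= flat x.
Proof. by rewrite /flat; case: ifP => // _; exact: expR_ge0. Qed.

Lemma flat_gt0 x : (0 < flat x) = (0 < x).
Proof. by rewrite /flat; case: ifP => _; rewrite ?expR_gt0 ?ltxx. Qed.

Lemma flat_eq0 x : x <= 0 -> flat x = 0.
Proof. by rewrite /flat leNgt => /negbTE ->. Qed.

Lemma ler_flat : {homo flat : x y / x <= y}.
Proof.
move=> x y xy; rewrite {1}/flat; case: ifPn => [x0|_]; last exact: flat_ge0.
have y0 := lt_le_trans x0 xy.
by rewrite /flat y0 ler_expR lerN2 lef_pV2.
Qed.

(* A smooth step: for [x >= b] the inner value [flat (b - x)] is exactly 0, so
   the plateau needs no quotient of smooth functions. *)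
Definition sstep b x : R := flat (flat b - flat (b - x)) / flat (flat b).

Lemma sstep_ge0 b x : 0 <= sstep b x.
Proof. by rewrite divr_ge0// flat_ge0. Qed.

Lemma sstep_le1 b x : 0 < b -> sstep b x <= 1.
Proof.
move=> b0; have fb : 0 < flat (flat b) by rewrite !flat_gt0.
by rewrite ler_pdivrMr// mul1r ler_flat// lerBlDr lerDl flat_ge0.
Qed.

Lemma sstep_eq0 b x : x <= 0 -> sstep b x = 0.
Proof.
move=> x0; rewrite /sstep [X in X / _]flat_eq0 ?mul0r//.
by rewrite subr_le0 ler_flat// lerBrDr gerDl.
Qed.

Lemma sstep_eq1 b x : 0 < b -> b <= x -> sstep b x = 1.
Proof.
move=> b0 bx; rewrite /sstep [flat (b - x)]flat_eq0 ?subr_le0// subr0 divff//.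
by rewrite gt_eqF// !flat_gt0.
Qed.

Lemma sstep_gt0 b x : 0 < b -> (0 < sstep b x) = (0 < x).
Proof.
move=> b0; apply/idP/idP => [|x0].
  by apply: contraTT; rewrite -!leNgt => /sstep_eq0 ->.
rewrite divr_gt0 ?flat_gt0 ?subr_gt0 ?flat_gt0//.
rewrite {2}/flat b0 {1}/flat; case: ifPn => [bx|_]; last exact: expR_gt0.
by rewrite ltr_expR ltrN2 ltf_pV2 ?posrE// ltrBlDr ltrDl.
Qed.

Lemma Csm_sstep b : Csm setT (sstep b).
Proof.
have oT := @openT R.
have Cl : Csm setT (fun x : R => b - x).
  by apply: CinfB => //; [exact: Cinf_cst|exact: Csm_id].
have := CinfM oT (Cinf_comp oT _ Csm_flat
  (CinfB oT (Cinf_cst _ _ (flat b)) (Cinf_comp oT _ Csm_flat Cl)))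
  (Cinf_cst _ _ (flat (flat b))^-1).
exact.
Qed.

(** Rises on [[a, b]], is 1 on [[b, c]] and falls on [[c, e]]. *)
Definition plateau a b c e x : R := sstep (b - a) (x - a) * sstep (e - c) (e - x).

Section plateau_theory.
Variables a b c e : R.
Hypotheses (ab : a < b) (ce : c < e).
Let ba0 : 0 < b - a. Proof. by rewrite subr_gt0. Qed.
Let ec0 : 0 < e - c. Proof. by rewrite subr_gt0. Qed.
Local Notation chi := (plateau a b c e).

Lemma plateau_ge0 x : 0 <= chi x.
Proof. by rewrite mulr_ge0// sstep_ge0. Qed.

Lemma plateau_le1 x : chi x <= 1.
Proof. by rewrite mulr_ile1// ?sstep_ge0 ?sstep_le1. Qed.

Lemma plateau_gt0 x : (0 < chi x) = (a < x < e).
Proof.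
rewrite -[a < x]subr_gt0 -[x < e]subr_gt0 -(sstep_gt0 (x - a) ba0)
  -(sstep_gt0 (e - x) ec0).
apply/idP/andP => [|[s1 s2]]; last exact: mulr_gt0 s1 s2.
move=> H; split; rewrite lt_def sstep_ge0 andbT; apply: contraTneq H => H.
  by rewrite /plateau H mul0r ltxx.
by rewrite /plateau H mulr0 ltxx.
Qed.

Lemma plateau_eq0 x : ~~ (a < x < e) -> chi x = 0.
Proof.
rewrite -plateau_gt0 -leNgt => H; apply/eqP.
by rewrite eq_le plateau_ge0 andbT.
Qed.

Lemma plateau_eq1 x : b <= x <= c -> chi x = 1.
Proof.
move=> /andP[bx xc]; rewrite /plateau !sstep_eq1 ?mulr1//.
  by rewrite lerD2l lerN2.
by rewrite lerD2r.
Qed.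

Lemma Csm_plateau : Csm setT chi.
Proof.
have oT := @openT R.
have C1 : Csm setT (fun x : R => x - a).
  by apply: CinfB => //; [exact: Csm_id|exact: Cinf_cst].
have C2 : Csm setT (fun x : R => e - x).
  by apply: CinfB => //; [exact: Cinf_cst|exact: Csm_id].
have := CinfM oT (Cinf_comp oT _ (Csm_sstep (b - a)) C1)
  (Cinf_comp oT _ (Csm_sstep (e - c)) C2).
exact.
Qed.

End plateau_theory.

End flat_function.

(** * Radial functions *)

Section radial_functions.
Context {R : realType} {d : nat}.
Implicit Types (x y v : 'rV[R]_d) (F g : R -> R).

Definition sqnorm x : R := \sum_(i < d) x 0 i ^+ 2.

Definition basis_dir (i : 'I_d) : 'rV[R]_d := delta_mx 0 i.

Lemma sqnorm_ge0 x : 0 <= sqnorm x.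
Proof. by apply: sumr_ge0 => i _; exact: sqr_ge0. Qed.

Lemma enorm_ge0 x : 0 <= enorm x.
Proof. exact: sqrtr_ge0. Qed.

Lemma sqr_enorm x : enorm x ^+ 2 = sqnorm x.
Proof. by rewrite sqr_sqrtr// sqnorm_ge0. Qed.

Lemma radial_sqnorm F : radial (F \o @sqnorm).
Proof. by move=> x y; rewrite /= -!sqr_enorm => ->. Qed.

Lemma sqnorm_eq0 x : (sqnorm x == 0) = (x == 0).
Proof.
apply/idP/eqP => [|->]; last first.
  by rewrite /sqnorm big1// => i _; rewrite mxE expr0n.
rewrite psumr_eq0 => [/allP H|i _]; last exact: sqr_ge0.
apply/rowP => i; have := H i (mem_index_enum i); rewrite /= sqrf_eq0 mxE.
by move/eqP.
Qed.

Lemma sqnorm_gt0 x : (0 < sqnorm x) = (x != 0).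
Proof. by rewrite lt_def sqnorm_ge0 andbT sqnorm_eq0. Qed.

Lemma enorm_gt0 x : (0 < enorm x) = (x != 0).
Proof. by rewrite sqrtr_gt0 sqnorm_gt0. Qed.

Lemma sqnormZ a x : sqnorm (a *: x) = a ^+ 2 * sqnorm x.
Proof.
by rewrite /sqnorm mulr_sumr; apply: eq_bigr => i _; rewrite mxE exprMn.
Qed.

Lemma enormZ a x : enorm (a *: x) = `|a| * enorm x.
Proof. by rewrite /enorm -/(sqnorm _) sqnormZ sqrtrM ?sqr_ge0// sqrtr_sqr. Qed.

Lemma is_derive_coord x v j :
  is_derive x v (fun y : 'rV[R]_d => y 0 j : R) (v 0 j).
Proof.
have H : (fun h : R => h^-1 *: (((fun y : 'rV[R]_d => y 0 j : R) \o shift x)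
    (h *: v) - x 0 j)) @ 0^' --> (v 0 j : R).
  apply: cvg_trans; last exact: (@cvg_cst _ (v 0 j) _ (0 : R)^' _).
  apply: near_eq_cvg; near=> h.
  have h0 : h != 0 by near: h; exact: nbhs_dnbhs_neq.
  by rewrite /= !mxE addrK [_ *: _]mulKf.
split; first by apply/cvg_ex; exists (v 0 j).
exact: cvg_lim H.
Unshelve. all: by end_near. Qed.

Lemma Cinf_coord j : Cinf basis_dir setT (fun y : 'rV[R]_d => y 0 j : R).
Proof.
have c : continuous (fun y : 'rV[R]_d => y 0 j : R).
  by move=> x; exact: coord_continuous.
case=> [|k]; first by split=> // x _; exact: c.
split=> [x _|i]; first exact: c.
split=> [x _|]; first by case: (is_derive_coord x (basis_dir i) j).
apply: eq_Ck (Ck_cst _ k _ (basis_dir i 0 j)) => [|x _]; first exact: openT.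
by case: (is_derive_coord x (basis_dir i) j).
Qed.

Lemma Cinf_sqnorm U : Cinf basis_dir U sqnorm.
Proof.
apply: (@Cinf_subset _ _ _ _ setT) => //.
apply: Cinf_sum => [|i]; first exact: openT.
by apply: CinfX; [exact: openT|exact: Cinf_coord].
Qed.

Lemma continuous_sqnorm : continuous (sqnorm : 'rV[R]_d -> R).
Proof. by move=> x; exact: (Cinf_continuous (@Cinf_sqnorm setT)). Qed.

Lemma continuous_enorm : continuous (enorm : 'rV[R]_d -> R).
Proof.
move=> x; apply: (@continuous_comp _ _ _ sqnorm Num.sqrt).
  exact: continuous_sqnorm.
exact: sqrt_continuous.
Qed.

Lemma derive_sqnorm x i : 'D_(basis_dir i) sqnorm x = x 0 i *+ 2.
Proof.
have E : sqnorm = \sum_(j < d) (fun y : 'rV[R]_d => (y 0 j : R)) ^+ 2.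
  by apply/funext => y; rewrite fct_sumE.
rewrite E derive_sum => [|j]; last first.
  have [d1 _] := is_derive_coord x (basis_dir i) j.
  exact: derivableX.
rewrite (bigD1 i)//= big1 ?addr0 => [|j ji].
  have [d1 d2] := is_derive_coord x (basis_dir i) i.
  by rewrite deriveX// d2 /basis_dir mxE !eqxx expr1 [_ *: _]mulr1 mulr_natl.
have [d1 d2] := is_derive_coord x (basis_dir i) j.
by rewrite deriveX// d2 /basis_dir mxE (negbTE ji) andbF scaler0.
Qed.

Lemma Cinf_radial (D : set R) (U : set 'rV[R]_d) F : open U ->
  (forall x, U x -> D (sqnorm x)) -> Csm D F ->
  Cinf basis_dir U (F \o sqnorm).
Proof. by move=> oU UD CF; exact: Cinf_comp oU UD CF (@Cinf_sqnorm U). Qed.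

Lemma smooth_on_Cinf U (f : 'rV[R]_d -> R) : Cinf basis_dir U f -> smooth_on U f.
Proof.
move=> Cf s x Ux; have C : Cinf basis_dir U (dparts s f).
  by elim: s => //= i s IH; exact: (Cinf_derive i IH).
split; first exact: Cinf_continuous C _ Ux.
by move=> i; exact: (Cinf_derivable (i := i) C Ux).
Qed.

Lemma dpart_radial F i : Csm setT F ->
  dpart i (F \o sqnorm) =
  fun x => ('D_(1 : R) F \o sqnorm) x * (x 0 i *+ 2).
Proof.
move=> CF; apply/funext => x.
rewrite -(derive_sqnorm x i); apply: derive_val.
apply: derive_compR.
  exact: (Cinf_derivable (i := i) (@Cinf_sqnorm setT)).
exact: (Cinf_derivable (i := tt) CF).
Qed.

Lemma laplacian_radial F x : Csm setT F ->
  laplacian (F \o sqnorm) x =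
  sqnorm x * 'D_(1 : R) ('D_(1 : R) F) (sqnorm x) *+ 4 +
  'D_(1 : R) F (sqnorm x) *+ (2 * d).
Proof.
move=> CF; have CF' : Csm setT ('D_(1 : R) F) := Cinf_derive tt CF.
have E i : dpart i (dpart i (F \o sqnorm)) x =
    x 0 i ^+ 2 * 'D_(1 : R) ('D_(1 : R) F) (sqnorm x) *+ 4 +
    'D_(1 : R) F (sqnorm x) *+ 2.
  rewrite dpart_radial//.
  have [d1 d2] := is_derive_coord x (basis_dir i) i.
  have dc : is_derive x (basis_dir i) (fun y : 'rV[R]_d => y 0 i *+ 2 : R) 2.
    have -> : (fun y : 'rV[R]_d => y 0 i *+ 2 : R) =
        2 *: (fun y : 'rV[R]_d => y 0 i : R).
      by apply/funext => y; rewrite -[LHS]mulr_natl.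
    split; first exact: derivableZ.
    by rewrite deriveZ// d2 /basis_dir mxE !eqxx [_ *: _]mulr1.
  have dF : derivable ('D_(1 : R) F \o sqnorm) x (basis_dir i).
    by apply: (@Cinf_derivable _ _ _ _ setT) => //; apply: Cinf_radial CF' => //;
       exact: openT.
  have dFE : 'D_(basis_dir i) ('D_(1 : R) F \o sqnorm) x =
      'D_(1 : R) ('D_(1 : R) F) (sqnorm x) * (x 0 i *+ 2).
    by rewrite -[LHS]/(dpart i _ x) dpart_radial.
  case: dc => dc1 dc2; rewrite /dpart.
  have := deriveM dF dc1; rewrite dc2 dFE => ->.
  by rewrite /GRing.scale /=; ring.
rewrite /laplacian (eq_bigr _ (fun i _ => E i)) big_split /=; congr (_ + _).
  by rewrite sumrMnl -mulr_suml.
by rewrite sumr_const card_ord -mulrnA.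
Qed.

(** Along the ray through [x] the norm is affine of slope 1: the point at signed distance [h] has
    norm [enorm x + h] as soon as [|h| < enorm x]. The agreement of [f] and [g] is only required off
    the origin, so that the result can be fed back to itself for higher derivatives. *)
Lemma radial_deriv_enorm (f : 'rV[R]_d -> R) g x : x != 0 ->
  (forall y, y != 0 -> f y = g (enorm y)) -> derivable g (enorm x) 1 ->
  radial_deriv f x = 'D_(1 : R) g (enorm x).
Proof.
move=> x0 fg dg; have nx : 0 < enorm x by rewrite enorm_gt0.
rewrite /radial_deriv /derive; congr (lim _).
have E : \forall h \near (0 : R)^', 
    h^-1 *: ((f \o shift x) (h *: ((enorm x)^-1 *: x)) - f x) =
    h^-1 *: ((g \o shift (enorm x)) (h *: (1 : R)) - g (enorm x)).
  near=> h; congr (_ *: (_ - _)); last exact: fg.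
  have hx : `|h| < enorm x by near: h; exact: dnbhs0_lt.
  have E1 : h *: ((enorm x)^-1 *: x) + x = (h / enorm x + 1) *: x.
    by rewrite scalerA scalerDl scale1r.
  have p : 0 < h / enorm x + 1.
    rewrite -ltrBlDr sub0r ltr_pdivlMr// mulN1r.
    by move: hx; rewrite ltr_norml => /andP[].
  have E2 : enorm (h *: ((enorm x)^-1 *: x) + x) = h + enorm x.
    by rewrite E1 enormZ gtr0_norm// mulrDl mul1r divfK// gt_eqF.
  rewrite /= fg; first by rewrite E2 [h%:A]mulr1.
  by rewrite E1 scaler_eq0 negb_or x0 gt_eqF.
rewrite eqEsubset; split; apply: near_eq_cvg => //.
by near do apply/esym.
Unshelve. all: by end_near. Qed.

Lemma radial_deriv0 (f : 'rV[R]_d -> R) : radial_deriv f 0 = 0.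
Proof. by rewrite /radial_deriv scaler0 derive0. Qed.

(** At the origin every derivative of positive order is 0 by the degenerate direction, so the bound
    holds there whatever the regularity of [f]. *)
Lemma iter_radial_deriv_le (f : 'rV[R]_d -> R) g C j : Csm setT g ->
  (forall x, f x = g (enorm x)) ->
  (forall t, `|nderive j g t| <= C) ->
  forall x, `|iter j radial_deriv f x| <= C.
Proof.
move=> Cg fg gC x; have C0 := le_trans (normr_ge0 _) (gC 0).
have [->|x0] := eqVneq x 0.
  by case: j gC => [|j] gC /=; rewrite ?radial_deriv0 ?normr0// fg.
suff -> : iter j radial_deriv f x = nderive j g (enorm x).
  exact: gC.
move: (x) x0; elim: j {gC} => [|j IH] y y0 //=.
apply: radial_deriv_enorm => //.
exact: Csm_derivable (Csm_nderive j Cg) _.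
Qed.

End radial_functions.

(** * Derivatives of Gaussian factors *)

Section line_estimates.
Context {R : realType}.
Implicit Types (f g : R -> R) (j : nat).

Lemma nderive_lin j f g (a b : R) : Csm setT f -> Csm setT g ->
  nderive j (fun s => a * f s + b * g s) =
  fun s => a * nderive j f s + b * nderive j g s.
Proof.
move=> Cf Cg; elim: j => // j IH; rewrite !nderiveS IH; apply/funext => s.
have df := Csm_derivable (Csm_nderive j Cf) (I : setT s).
have dg := Csm_derivable (Csm_nderive j Cg) (I : setT s).
have := deriveD (derivableZ (k := a) df) (derivableZ (k := b) dg).
by rewrite deriveZ// deriveZ.
Qed.

Lemma nderive_scale j g (c k : R) : Csm setT g ->
  nderive j (fun t => c * g (k * t)) = fun t => c * k ^+ j * nderive j g (k * t).
Proof.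
move=> Cg; elim: j => [|j IH]; first by apply/funext => s /=; rewrite expr0 mulr1.
rewrite !nderiveS IH; apply/funext => t.
have dk : is_derive t 1 (fun t : R => k * t) k.
  have := is_deriveZ k (is_derive_id t (1 : R)).
  by rewrite [k *: (1 : R)]mulr1.
have dg := derivableP (Csm_derivable (Csm_nderive j Cg) (I : setT (k * t))).
have [d1 d2] := is_derive_comp dk dg.
have := deriveZ (c * k ^+ j) d1; rewrite d2 => ->.
by rewrite /GRing.scale /= exprSr; ring.
Qed.

(** Differentiation maps an amplitude [a] to the amplitudes [a'] and [a * psi'], the latter with
    weight [- L]. The factor [1 *] gives the right-hand side the shape expected by [nderive_lin]. *)
Lemma derive_gauss (a psi : R -> R) (L : R) : Csm setT a -> Csm setT psi ->
  'D_(1 : R) (fun s => a s * expR (- (L * psi s))) =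
  fun s => 1 * ('D_(1 : R) a s * expR (- (L * psi s))) +
           (- L) * ((a s * 'D_(1 : R) psi s) * expR (- (L * psi s))).
Proof.
move=> Ca Cpsi; apply/funext => s.
have da := Csm_derivable Ca (I : setT s).
have dpsi := derivableP (Csm_derivable Cpsi (I : setT s)).
have d1 : is_derive s 1 (fun s => - (L * psi s)) (- (L * 'D_1 psi s)).
  exact: is_deriveN (is_deriveZ L dpsi).
have [d2 d3] := is_derive_comp d1 (is_derive_expR _).
by rewrite [LHS](deriveM da d2) d3 /GRing.scale /=; ring.
Qed.

Lemma Csm_gauss (a psi : R -> R) (L : R) : Csm setT a -> Csm setT psi ->
  Csm setT (fun s => a s * expR (- (L * psi s))).
Proof.
move=> Ca Cpsi; have oT := @openT R; apply: (CinfM oT Ca).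
apply: (Cinf_comp (D := setT) (F := expR) (g := fun s => - (L * psi s)) oT) => //.
  exact: Csm_expR.
apply: (CinfN oT).
exact: (CinfM oT (Cinf_cst _ _ L) Cpsi).
Qed.

(** Induction on [j] over all amplitudes at once: both amplitudes produced by one derivative are
    again smooth and zero off [K], and each derivative costs at most one factor [L]. The constant is
    chosen before [L]. *)
Lemma nderive_gauss_le (K : set R) (b kappa : R) (psi : R -> R) j a :
  closed K -> K `<=` [set` `[- b, b]] -> Csm setT psi ->
  (forall s, K s -> kappa <= psi s) ->
  Csm setT a -> (forall s, ~ K s -> a s = 0) ->
  exists2 C, 0 <= C & forall L, 1 <= L -> forall s,
    `|nderive j (fun s => a s * expR (- (L * psi s))) s| <=
      C * L ^+ j * expR (- (L * kappa)).
Proof.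
move=> cK Kb Cpsi Kpsi; elim: j a => [|j IH] a Ca a0.
  have [b0|b0] := leP (- b) b; last first.
    exists 0 => // L _ s /=; rewrite a0 ?mul0r ?normr0//.
    by move=> /Kb /=; rewrite in_itv /= => /andP[/le_trans H /H]; rewrite leNgt b0.
  (* At order 0 the amplitude is bounded by its maximum on the compact interval containing [K]. *)
  have ca : {within `[- b, b], continuous (fun s => `|a s|)}.
    apply: continuous_subspaceT => s; apply: continuous_comp.
      exact: (Cinf_continuous Ca).
    exact: norm_continuous.
  have [c _ cmax] := EVT_max b0 ca.
  exists `|a c| => // L L1 s /=.
  have [Ks|nK] := pselect (K s); last first.
    by rewrite a0// mul0r normr0 mulr_ge0// ?mulr_ge0 ?expR_ge0.
  rewrite normrM (ger0_norm (expR_ge0 _)) expr0 mulr1 ler_pM ?expR_ge0//.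
    exact: cmax (Kb _ Ks).
  by rewrite ler_expR lerN2 ler_wpM2l ?Kpsi// (le_trans _ L1).
have Ca' : Csm setT ('D_(1 : R) a) := Cinf_derive tt Ca.
have Cp' : Csm setT ('D_(1 : R) psi) := Cinf_derive tt Cpsi.
have Cap : Csm setT (fun s => a s * 'D_(1 : R) psi s).
  exact: (CinfM (@openT R) Ca Cp').
(* The complement of the closed set [K] is open, so the amplitude vanishes near [s] and its
   derivative vanishes at [s]. *)
have a'0 s : ~ K s -> 'D_(1 : R) a s = 0.
  move=> nK; rewrite (@near_eq_derive _ _ _ a (fun=> 0)) ?derive_cst//.
  have : nbhs s (~` K) by apply: open_nbhs_nbhs; split => //; exact: closed_openC.
  by apply: filterS => y /a0.
have [C1 C10 H1] := IH _ Ca' a'0.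
have [|C2 C20 H2] := IH _ Cap; first by move=> s /a0 ->; rewrite mul0r.
exists (C1 + C2); first exact: addr_ge0.
move=> L L1 s; have L0 : 0 <= L by rewrite (le_trans _ L1).
rewrite nderiveSr derive_gauss// nderive_lin; first last.
- exact: Csm_gauss.
- exact: Csm_gauss.
apply: le_trans (ler_normD _ _) _; rewrite mul1r normrM normrN (ger0_norm L0).
rewrite mulrDl mulrDl lerD//.
  apply: le_trans (H1 _ L1 s) _; rewrite ler_wpM2r ?expR_ge0// ler_wpM2l//.
  by rewrite exprS ler_peMl// exprn_ge0.
rewrite exprS [C2 * _]mulrCA -mulrA ler_wpM2l//.
exact: H2.
Qed.

End line_estimates.

(** * Norms of radial functions *)

Section radial_L1.
Context {R : realType} {d : nat}.
Implicit Types (G : R -> R).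
Local Notation row_of t := (\row_(i < d) tnth t i : 'rV[R]_d).
Local Notation mu :=
  (lebesgueRn d : {measure set (d.-tuple (measurableTypeR R)) -> \bar R}).

Lemma measurable_radial G : continuous G ->
  measurable_fun [set: d.-tuple (measurableTypeR R)]
    (fun t => G (sqnorm (row_of t))).
Proof.
move=> cG; apply: measurableT_comp; first exact: continuous_measurable_fun.
rewrite (_ : (fun t => _) = fun t : d.-tuple (measurableTypeR R) =>
    \sum_(i < d) tnth t i ^+ 2); last first.
  by apply/funext => t; apply: eq_bigr => i _; rewrite mxE.
by apply: measurable_sum => i; apply: measurable_funX; exact: measurable_tnth.
Qed.

Lemma normL1_radial G : (forall q, 0 <= G q) ->
  normL 1 (G \o @sqnorm R d) = (\int[mu]_t (G (sqnorm (row_of t)))%:E)%E.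
Proof.
move=> G0; rewrite /normL Lnorm1; apply: eq_integral => t _.
by rewrite /= ger0_norm.
Qed.

Lemma normL1_radialZ G (a : R) : continuous G -> (forall q, 0 <= G q) -> 0 <= a ->
  normL 1 ((fun q => a * G q) \o @sqnorm R d) =
  (a%:E * normL 1 (G \o @sqnorm R d))%E.
Proof.
move=> cG G0 a0; rewrite !normL1_radial// => [|q]; last exact: mulr_ge0.
under eq_integral do rewrite EFinM.
rewrite ge0_integralZl//.
- by apply/measurable_EFinP; exact: measurable_radial.
- by move=> t _; rewrite lee_fin.
Qed.

Lemma lebesgueRn_cube (a b : R) : a < b ->
  mu [set t | forall i, [set` `[a, b]] (tnth t i)] = ((b - a) ^+ d)%:E.
Proof.
move=> ab.
transitivity (\prod_(i < d) lebesgue_measure ([set` `[a, b]] : set R))%E.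
  apply: (@lebesgueRn_box R d (fun=> [set` `[a, b]])) => i.
  exact: measurable_itv.
rewrite lebesgue_measure_itv /= lte_fin ab -EFinD.
by elim: d => [|n IH]; rewrite ?big_ord0 ?expr0// big_ord_recl IH -EFinM exprS.
Qed.

Lemma measurable_cube (a b : R) :
  measurable [set t : d.-tuple (measurableTypeR R) |
    forall i, [set` `[a, b]] (tnth t i)].
Proof.
rewrite (_ : [set _ | _] = \bigcap_(i in [set: 'I_d])
    (fun t : d.-tuple (measurableTypeR R) => tnth t i) @^-1` [set` `[a, b]]).
  apply: fin_bigcap_measurable => // i _.
  have mI : measurable ([set` `[a, b]] : set R) by exact: measurable_itv.
  by rewrite -[X in measurable X]setTI; exact: measurable_tnth.
by apply/seteqP; split=> t /= h i => [_|]; exact: h.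
Qed.

(* The lower bound comes from the cube [w, 17w/16]^d, which lies in the annulus
   [rho^2 <= |x|^2 <= 5/4 rho^2]. *)
Lemma normL1_radial_bounds G (rho w m : R) : continuous G ->
  (forall q, 0 <= G q <= 1) -> 0 < rho -> 0 < w -> w ^+ 2 *+ d = rho ^+ 2 ->
  (forall q, 4 * rho ^+ 2 <= q -> G q = 0) ->
  (forall q, rho ^+ 2 <= q <= 5 / 4 * rho ^+ 2 -> m <= G q) -> 0 <= m ->
  exists2 I : R, normL 1 (G \o @sqnorm R d) = I%:E & m * (w / 16) ^+ d <= I.
Proof.
move=> cG G01 rho0 w0 wd Gout Gin m0.
have G0 q : 0 <= G q by have /andP[] := G01 q.
have mG := measurable_radial cG.
rewrite normL1_radial//.
have muE a b : mu [set t | forall i, [set` `[a, b]] (tnth t i)] =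
    (\int[mu]_t (\1_[set t | forall i, [set` `[a, b]] (tnth t i)] t)%:E)%E.
  by rewrite integral_indic ?setIT//; exact: measurable_cube.
(* The function is at most the indicator of the cube [[- 2 rho, 2 rho]^d]; this only serves to make
   the norm a real number. *)
have ub : (\int[mu]_t (G (sqnorm (row_of t)))%:E <=
    ((2 * rho - - (2 * rho)) ^+ d)%:E)%E.
  rewrite -lebesgueRn_cube; last by lra.
  rewrite muE.
  apply: ge0_le_integral => //.
  - by move=> t _; rewrite lee_fin.
  - by apply/measurable_EFinP.
  - by apply/measurable_EFinP; apply: measurable_indic; exact: measurable_cube.
  move=> t _; rewrite lee_fin indicE.
  have [_|nt] := boolP (t \in _); first by have /andP[] := G01 (sqnorm (row_of t)).
  rewrite Gout// leNgt; apply: contra nt => tq; rewrite inE /= => i.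
  rewrite in_itv /= -ler_norml.
  have r2 : 0 <= 2 * rho by rewrite mulr_ge0// ltW.
  rewrite -(ger0_norm r2) -ler_sqr ?nnegrE// !real_normK ?num_real// exprMn.
  have -> : 2 ^+ 2 = 4 :> R by ring.
  apply/ltW; apply: le_lt_trans tq.
  rewrite /sqnorm (bigD1 i)//= mxE lerDl; apply: sumr_ge0 => j _; exact: sqr_ge0.
have lb : ((m * (w / 16) ^+ d)%:E <= \int[mu]_t (G (sqnorm (row_of t)))%:E)%E.
  (* The cube has side [w / 16]; it stays inside the annulus since [(17 / 16)^2 <= 5 / 4]. *)
  have -> : w / 16 = 17 / 16 * w - w by field.
  rewrite EFinM -lebesgueRn_cube; last by lra.
  rewrite muE -ge0_integralZl//; first last.
  - by apply/measurable_EFinP; apply: measurable_indic; exact: measurable_cube.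
  apply: ge0_le_integral => //.
  - by move=> t _; rewrite mule_ge0// lee_fin.
  - apply: measurable_funeM.
    by apply/measurable_EFinP; apply: measurable_indic; exact: measurable_cube.
  - by apply/measurable_EFinP.
  move=> t _; rewrite -EFinM lee_fin indicE.
  have [|nt] := boolP (t \in _); last by rewrite mulr0.
  rewrite inE /= mulr1 => Ht; apply: Gin; rewrite -wd /sqnorm.
  have -> : w ^+ 2 *+ d = \sum_(i < d) w ^+ 2 by rewrite sumr_const card_ord.
  rewrite mulr_sumr; apply/andP; split; apply: ler_sum => i _; rewrite mxE;
    have := Ht i; rewrite in_itv /= => /andP[h1 h2].
    by rewrite ler_sqr ?nnegrE ?(ltW w0)// (le_trans (ltW w0)).
  apply: (@le_trans _ _ ((17 / 16 * w) ^+ 2)).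
    rewrite ler_sqr ?nnegrE//; last by lra.
    exact: le_trans (ltW w0) h1.
  by rewrite exprMn ler_wpM2r ?sqr_ge0//; lra.
exists (fine (\int[mu]_t (G (sqnorm (row_of t)))%:E)).
  rewrite fineK// ge0_fin_numE; first exact: le_lt_trans ub (ltry _).
  by apply: integral_ge0 => t _; rewrite lee_fin.
rewrite -lee_fin fineK// ge0_fin_numE; first exact: le_lt_trans ub (ltry _).
by apply: integral_ge0 => t _; rewrite lee_fin.
Qed.

Lemma normLy_le (f : 'rV[R]_d -> R) C : (forall x, `|f x| <= C) ->
  (normL +oo f <= C%:E)%E.
Proof.
move=> fC; rewrite /normL unlock.
(* The second branch is the default value 0 of the norm, and [0 <= C] follows from the bound at one
   point. *)
case: ifPn => _; last by rewrite lee_fin (le_trans _ (fC 0)).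
by apply/ess_supP; apply: nearW => t; rewrite /= lee_fin.
Qed.

End radial_L1.

(** * The profile of a well *)

Section profile.
Context {R : realType}.
Implicit Types (a L q s : R) (j d : nat).

(** In the variable [q = |x|^2 / rho^2]: the edges 1/4 and 9/4 correspond to [|x| = rho / 2] and
    [|x| = 3 rho / 2], and both transition layers satisfy [|q - 1| >= 1 / 2]. *)
Definition cutoff : R -> R := plateau (1 / 4) (1 / 2) 2 (9 / 4).

Definition well a q : R := a * (q - 1) ^+ 2.

Definition profile a L q : R := cutoff q * expR (- (L * well a q)).

(* The potential, in units of [lambda ^ 2], for which [expR (- (L * well a q))],
   as a function of [q = |x|^2 / rho^2], is an exact eigenfunction. *)
Definition well_potential d a L q : R :=
  1 + 16 * a ^+ 2 * q * (q - 1) ^+ 2 - (8 * a * q + 4 * d%:R * a * (q - 1)) / L.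

Lemma Csm_cutoff : Csm setT cutoff.
Proof. exact: Csm_plateau. Qed.

Lemma cutoff_gt0 q : (0 < cutoff q) = (1 / 4 < q < 9 / 4).
Proof. by rewrite plateau_gt0//; lra. Qed.

Lemma cutoff_ge0 q : 0 <= cutoff q.
Proof. exact: plateau_ge0. Qed.

Lemma cutoff_le1 q : cutoff q <= 1.
Proof. by rewrite plateau_le1//; lra. Qed.

Lemma cutoff_eq0 q : ~~ (1 / 4 < q < 9 / 4) -> cutoff q = 0.
Proof. by move=> H; rewrite /cutoff plateau_eq0//; lra. Qed.

Lemma cutoff_eq1 q : 1 / 2 <= q <= 2 -> cutoff q = 1.
Proof. by move=> H; rewrite /cutoff plateau_eq1//; lra. Qed.

Lemma is_derive_well a q : is_derive q 1 (well a) (2 * a * (q - 1)).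
Proof.
pose f : R -> R := fun q => q - 1.
have d1 : is_derive q 1 f 1.
  rewrite -[X in is_derive _ _ _ X]subr0.
  exact: is_deriveB (is_derive_id _ _) (is_derive_cst _ _ _).
have -> : well a = a *: (f * f).
  by apply/funext => y; rewrite /well expr2.
have -> : 2 * a * (q - 1) = a *: (f q *: 1 + f q *: 1).
  by rewrite /GRing.scale /= /f; ring.
exact: is_deriveZ (is_deriveM d1 d1).
Qed.

Lemma derive_well a q : 'D_(1 : R) (well a) q = 2 * a * (q - 1).
Proof. by case: (is_derive_well a q). Qed.

Lemma Csm_affine (b c : R) : Csm setT (fun q : R => b * (q - c)).
Proof.
have oT := @openT R; apply: (CinfM oT (Cinf_cst _ _ b)).
exact: (CinfB oT (Csm_id oT) (Cinf_cst _ _ c)).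
Qed.

Lemma Csm_well a : Csm setT (well a).
Proof.
have oT := @openT R; apply: (CinfM oT (Cinf_cst _ _ a)); apply: (CinfX _ oT).
exact: (CinfB oT (Csm_id oT) (Cinf_cst _ _ 1)).
Qed.

Lemma Csm_profile a L : Csm setT (profile a L).
Proof. exact: (Csm_gauss L Csm_cutoff (Csm_well a)). Qed.

Lemma profile_ge0 a L q : 0 <= profile a L q.
Proof. by rewrite mulr_ge0 ?cutoff_ge0 ?expR_ge0. Qed.

Lemma profile_le1 a L q : 0 <= a -> 0 <= L -> profile a L q <= 1.
Proof.
move=> a0 L0; rewrite mulr_ile1 ?cutoff_ge0 ?cutoff_le1 ?expR_ge0//.
by rewrite expR_le1 oppr_le0 mulr_ge0// mulr_ge0// sqr_ge0.
Qed.

(** The remaining region is where the Gaussian is small. The threshold 4, beyond the edge 9/4 of the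
    support, is a perfect square, which confines [s] to [[- 2, 2]] once [q = s ^+ 2]. *)
Lemma derive_cutoff_eq0 q : (1 / 2 < q < 2) || (4 < q) ->
  'D_(1 : R) cutoff q = 0 /\ 'D_(1 : R) ('D_(1 : R) cutoff) q = 0.
Proof.
pose O : set R := [set q | 1 / 2 < q < 2] `|` [set q | 4 < q].
have oO : open O.
  apply: openU; last exact: open_gt.
  rewrite (_ : [set q | _] = [set q | 1 / 2 < q] `&` [set q | q < 2]).
    by apply: openI; [exact: open_gt|exact: open_lt].
  by apply/seteqP; split => y /=; [move/andP|move=> []; move=> -> ->].
have D0 y : O y -> 'D_(1 : R) cutoff y = 0.
  case=> /= Hy.
    rewrite (@near_eq_derive _ _ _ cutoff (fun=> 1)) ?derive_cst//.
    have : nbhs y [set q | 1 / 2 < q < 2].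
      rewrite (_ : [set q | _] = [set q | 1 / 2 < q] `&` [set q | q < 2]).
        have /andP[h1 h2] := Hy; apply: filterI.
          exact: open_nbhs_nbhs (conj (@open_gt _ _) h1).
        exact: open_nbhs_nbhs (conj (@open_lt _ _) h2).
      by apply/seteqP; split => z /=; [move/andP|move=> []; move=> -> ->].
    by apply: filterS => z /= zO; rewrite cutoff_eq1//; lra.
  rewrite (@near_eq_derive _ _ _ cutoff (fun=> 0)) ?derive_cst//.
  have : nbhs y [set q | 4 < q] by exact: open_nbhs_nbhs (conj (@open_gt _ _) Hy).
  by apply: filterS => z /= zO; rewrite cutoff_eq0//; lra.
move=> Hq; have Oq : O q by case/orP: Hq; [left|right].
split; first exact: D0.
rewrite (@near_eq_derive _ _ _ ('D_(1 : R) cutoff) (fun=> 0)) ?derive_cst//.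
by apply: filterS (open_nbhs_nbhs (conj oO Oq)) => z /D0.
Qed.

(** The left-hand side is the Laplacian of a function of the squared norm. The terms in which the
    cutoff is not differentiated are those of the pure Gaussian, and [well_potential] is defined so
    that they add up to the last summand. *)
Lemma profile_laplacian d a L q : L != 0 ->
  4 * q * 'D_(1 : R) ('D_(1 : R) (profile a L)) q +
    (2 * d%:R) * 'D_(1 : R) (profile a L) q =
  ((4 * q * 'D_(1 : R) ('D_(1 : R) cutoff) q + 2 * d%:R * 'D_(1 : R) cutoff q)
    - L * (16 * a * q * (q - 1) * 'D_(1 : R) cutoff q)) *
    expR (- (L * well a q))
  + L ^+ 2 * (well_potential d a L q - 1) * profile a L q.
Proof.
move=> L0; have oT := @openT R.
pose chi' : R -> R := 'D_(1 : R) cutoff.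
have Cc : Csm setT cutoff := Csm_cutoff.
have Cc' : Csm setT chi' := Cinf_derive tt Cc.
have Cw : Csm setT (fun q : R => 2 * a * (q - 1)) := Csm_affine (2 * a) 1.
have Ccw : Csm setT (fun q => cutoff q * (2 * a * (q - 1))) := CinfM oT Cc Cw.
have dcw : 'D_(1 : R) (fun q => cutoff q * (2 * a * (q - 1))) q =
    cutoff q * (2 * a) + chi' q * (2 * a * (q - 1)).
  have dw : is_derive q 1 (fun q : R => 2 * a * (q - 1)) (2 * a).
    have := is_deriveZ (2 * a) (is_deriveB (is_derive_id q (1 : R))
      (is_derive_cst (1 : R) q 1)).
    by rewrite subr0 [_ *: _]mulr1.
  case: dw => dw1 dw2.
  rewrite [LHS](deriveM (Csm_derivable Cc I) dw1) dw2 /GRing.scale /=.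
  by congr (_ + _); rewrite mulrC.
have Cpsi := Csm_well a.
have E1 : 'D_(1 : R) (profile a L) = fun s =>
    1 * (chi' s * expR (- (L * well a s))) +
    (- L) * ((cutoff s * (2 * a * (s - 1))) * expR (- (L * well a s))).
  rewrite [LHS](derive_gauss L Cc Cpsi); apply/funext => s.
  by rewrite derive_well.
have E2 : 'D_(1 : R) ('D_(1 : R) (profile a L)) q =
    1 * (1 * ('D_(1 : R) chi' q * expR (- (L * well a q))) +
      (- L) * ((chi' q * (2 * a * (q - 1))) * expR (- (L * well a q)))) +
    (- L) * (1 * ((cutoff q * (2 * a) + chi' q * (2 * a * (q - 1))) *
        expR (- (L * well a q))) +
      (- L) * ((cutoff q * (2 * a * (q - 1)) * (2 * a * (q - 1))) *
        expR (- (L * well a q)))).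
  rewrite E1 [LHS](congr1 (@^~ q) (nderive_lin 1 1 (- L)
    (Csm_gauss L Cc' Cpsi) (Csm_gauss L Ccw Cpsi))) /nderive /=.
  have D b : Csm setT b -> _ := fun Cb =>
    congr1 (@^~ q) (derive_gauss L Cb Cpsi).
  by rewrite [X in _ + _ * X](D _ Ccw) [X in _ * X + _](D _ Cc') derive_well dcw.
rewrite E2 (congr1 (@^~ q) E1) /well_potential /profile -/chi' /=.
(* The derivatives and the exponential are abstracted into real variables, which reduces the
   identity to one of rational functions. *)
have alg (c2 c1 c0 e : R) :
    4 * q * (1 * (1 * (c2 * e) + - L * (c1 * (2 * a * (q - 1)) * e)) +
      - L * (1 * ((c0 * (2 * a) + c1 * (2 * a * (q - 1))) * e) +
        - L * (c0 * (2 * a * (q - 1)) * (2 * a * (q - 1)) * e))) +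
    2 * d%:R * (1 * (c1 * e) + - L * (c0 * (2 * a * (q - 1)) * e)) =
    (4 * q * c2 + 2 * d%:R * c1 - L * (16 * a * q * (q - 1) * c1)) * e +
    L ^+ 2 * (1 + 16 * a ^+ 2 * q * (q - 1) ^+ 2 -
      (8 * a * q + 4 * d%:R * a * (q - 1)) / L - 1) * (c0 * e).
  by field.
exact: alg.
Qed.

(* The error produced by the cutoff, in the variable [s = |x| / rho], split
   according to the power of [L]. *)
Definition source0 d s : R :=
  - (4 * s ^+ 2 * 'D_(1 : R) ('D_(1 : R) cutoff) (s ^+ 2)
     + 2 * d%:R * 'D_(1 : R) cutoff (s ^+ 2)).

Definition source1 a s : R :=
  16 * a * s ^+ 2 * (s ^+ 2 - 1) * 'D_(1 : R) cutoff (s ^+ 2).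

Definition source d a L s : R :=
  1 * (source0 d s * expR (- (L * well a (s ^+ 2)))) +
  L * (source1 a s * expR (- (L * well a (s ^+ 2)))).

Lemma Csm_sqr : Csm setT (fun s : R => s ^+ 2).
Proof. by apply: CinfX; [exact: openT|apply: Csm_id; exact: openT]. Qed.

Lemma Csm_source0 d : Csm setT (source0 d).
Proof.
have oT := @openT R; have Cc := Csm_cutoff.
have Cc' : Csm setT ('D_(1 : R) cutoff) := Cinf_derive tt Cc.
have Cc'' : Csm setT ('D_(1 : R) ('D_(1 : R) cutoff)) := Cinf_derive tt Cc'.
have C1 := Cinf_comp oT (fun _ _ => I) Cc' Csm_sqr.
have C2 := Cinf_comp oT (fun _ _ => I) Cc'' Csm_sqr.
apply: CinfN => //; apply: CinfD => //; last exact: (CinfM oT (Cinf_cst _ _ _) C1).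
exact: (CinfM oT (CinfM oT (Cinf_cst _ _ 4) Csm_sqr) C2).
Qed.

Lemma Csm_source1 a : Csm setT (source1 a).
Proof.
have oT := @openT R; have Cc := Csm_cutoff.
have Cc' : Csm setT ('D_(1 : R) cutoff) := Cinf_derive tt Cc.
have C1 := Cinf_comp oT (fun _ _ => I) Cc' Csm_sqr.
have C2 := CinfB oT Csm_sqr (Cinf_cst _ _ 1).
have C3 := CinfM oT (Cinf_cst _ _ (16 * a)) Csm_sqr.
exact: (CinfM oT (CinfM oT C3 C2) C1).
Qed.

Lemma Csm_well_sqr a : Csm setT (fun s => well a (s ^+ 2)).
Proof. exact: (Cinf_comp (@openT R) (fun _ _ => I) (Csm_well a) Csm_sqr). Qed.

Lemma Csm_source d a L : Csm setT (source d a L).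
Proof.
have oT := @openT R; have Cw := Csm_well_sqr a.
exact: (CinfD oT
  (CinfM oT (Cinf_cst _ _ 1) (Csm_gauss L (Csm_source0 d) Cw))
  (CinfM oT (Cinf_cst _ _ L) (Csm_gauss L (Csm_source1 a) Cw))).
Qed.

(** One power of [L] comes from each derivative and one more from the factor in front of
    [source1]. *)
Lemma nderive_source_le d a j : 0 <= a -> exists2 C, 0 <= C &
  forall L, 1 <= L -> forall s,
    `|nderive j (source d a L) s| <= C * L ^+ j.+1 * expR (- (L * (a / 4))).
Proof.
move=> a0.
(* A compact set containing the supports of the two amplitudes, on which
   [(s ^+ 2 - 1) ^+ 2 >= 1 / 4], hence the exponent [a / 4]. *)
pose K : set R :=
  [set s | 1 / 2 <= `|s ^+ 2 - 1|] `&` [set s | s ^+ 2 <= 4].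
have csq : continuous (fun s : R => s ^+ 2).
  by move=> s; exact: (Cinf_continuous Csm_sqr).
have cK : closed K.
  apply: closedI.
    apply: (@closed_comp _ _ (fun s : R => `|s ^+ 2 - 1|) [set y | 1 / 2 <= y]).
      move=> s _; apply: (@continuous_comp _ _ _ (fun s : R => s ^+ 2 - 1)).
        by apply: cvgB; [exact: csq|exact: cvg_cst].
      exact: norm_continuous.
    exact: closed_ge.
  apply: (@closed_comp _ _ (fun s : R => s ^+ 2) [set y | y <= 4]).
    by move=> s _; exact: csq.
  exact: closed_le.
have Kb : K `<=` [set` `[- 2, 2]].
  by move=> s [_ /= s4]; rewrite in_itv /=; nra.
have Kpsi s : K s -> a / 4 <= well a (s ^+ 2).
  move=> [/= s1 _]; rewrite ler_wpM2l// -[X in _ <= X]real_normK ?num_real//.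
  by nra.
have off s : ~ K s -> (1 / 2 < s ^+ 2 < 2) || (4 < s ^+ 2).
  move=> nK; have [_|s4] := ltP 4 (s ^+ 2); first by rewrite orbT.
  have [s1|] := leP (1 / 2) `|s ^+ 2 - 1|; first by exfalso; exact: nK.
  by rewrite ltr_norml => /andP[? ?]; rewrite orbF; lra.
have off0 s : ~ K s -> source0 d s = 0.
  by move=> /off /derive_cutoff_eq0 [d1 d2]; rewrite /source0 d1 d2; ring.
have off1 s : ~ K s -> source1 a s = 0.
  by move=> /off /derive_cutoff_eq0 [d1 _]; rewrite /source1 d1; ring.
have [C0 C00 H0] :=
  nderive_gauss_le j cK Kb (Csm_well_sqr a) Kpsi (Csm_source0 d) off0.
have [C1 C10 H1] :=
  nderive_gauss_le j cK Kb (Csm_well_sqr a) Kpsi (Csm_source1 a) off1.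
exists (C0 + C1); first exact: addr_ge0.
move=> L L1 s; have L0 : 0 <= L by rewrite (le_trans _ L1).
rewrite nderive_lin; first last.
- exact: Csm_gauss (Csm_source1 a) (Csm_well_sqr a).
- exact: Csm_gauss (Csm_source0 d) (Csm_well_sqr a).
apply: le_trans (ler_normD _ _) _; rewrite mul1r normrM (ger0_norm L0).
rewrite !mulrDl lerD//.
  apply: le_trans (H0 _ L1 s) _; rewrite ler_wpM2r ?expR_ge0// ler_wpM2l//.
  by rewrite exprS ler_peMl// exprn_ge0.
rewrite exprS [C1 * _]mulrCA -mulrA ler_wpM2l//.
exact: H1.
Qed.

End profile.

(** * The potential *)

Section potential.
Context {R : realType} (d a M : nat).
Hypothesis M_large : (100 + 64 * a + 24 * (d * a) <= M)%N.
Implicit Types (q y : R) (m n : nat).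

Local Notation A := (a%:R : R).

(** The shift [n.+1] keeps every level at least [M]. In the lower bound on [M], the part
    [64 * a + 24 * (d * a)] holds the [1 / L] correction of the well potential within 1/2, and 100
    leaves room in the numerical estimates. *)
Definition level n : R := (M * n.+1)%:R.
Definition lam n : R := expR (level n).
Definition rho n : R := level n / lam n.

Let M_ge : 100 + 64 * A + 24 * (d%:R * A) <= M%:R.
Proof.
have := M_large; rewrite -(ler_nat R) (natrD R (100 + 64 * a)%N).
by rewrite (natrD R 100) (natrM R 64 a) (natrM R 24) (natrM R d).
Qed.

Let A0 : 0 <= A. Proof. by []. Qed.
Let dA0 : 0 <= d%:R * A. Proof. by rewrite mulr_ge0. Qed.

Let level_ge n : M%:R <= level n.
Proof. by rewrite ler_nat leq_pmulr. Qed.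

Let level100 n : 100 <= level n.
Proof. by have := level_ge n; have := M_ge; have := dA0; have := A0; lra. Qed.

Let level_geS n : n.+1%:R <= level n.
Proof.
rewrite ler_nat leq_pmull//; apply: leq_trans M_large.
by rewrite -addnA ltn_addr.
Qed.

Lemma level_ge1 n : 1 <= level n.
Proof. by have := level100 n; lra. Qed.

Lemma level_gt0 n : 0 < level n.
Proof. by have := level100 n; lra. Qed.

Lemma lam_gt0 n : 0 < lam n. Proof. exact: expR_gt0. Qed.

Lemma ln_lam n : ln (lam n) = level n. Proof. exact: expRK. Qed.

Lemma levelS n : level n.+1 = level n + M%:R.
Proof. by rewrite /level mulnS addnC natrD. Qed.

Lemma lam_incr m n : (m < n)%N -> lam m < lam n.
Proof.
move=> mn; rewrite ltr_expR ltr_nat ltn_pmul2l//.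
by apply: leq_trans M_large; rewrite -addnA ltn_addr.
Qed.

Lemma level_lt_lam n : level n < lam n.
Proof. by have := expR_ge1Dx (level n); rewrite -/(lam n); lra. Qed.

Lemma lam_cvg : lam n @[n --> \oo] --> +oo.
Proof.
apply/cvgryPge => B; near=> n.
apply: le_trans (ltW (level_lt_lam n)); apply: le_trans (level_geS n).
have : (Num.truncn B <= n)%N by near: n; exact: nbhs_infty_ge.
move=> Bn; apply: le_trans (ltW (truncnS_gt B)) _.
by rewrite ler_nat.
Unshelve. all: by end_near. Qed.

Lemma rho_gt0 n : 0 < rho n.
Proof. by rewrite divr_gt0 ?level_gt0 ?lam_gt0. Qed.

Lemma sqr_rho_gt0 n : 0 < rho n ^+ 2.
Proof. by rewrite exprn_gt0 ?rho_gt0. Qed.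

(** By [exp (2 L) >= (2 L)^4 / 24] and [n.+1 <= L]. This bounds the index of a well reaching [q] by
    [1 / q], and places all wells in [q <= 1 / 2]. *)
Lemma sqr_rho_small n : 8 * rho n ^+ 2 * n.+1%:R <= 1.
Proof.
have L0 := level_gt0 n; have l0 := lam_gt0 n.
rewrite /rho expr_div_n mulrAC mulrA ler_pdivrMr ?exprn_gt0// mul1r.
have -> : lam n ^+ 2 = expR (2 * level n) by rewrite /lam -expRM_natl.
have L20 : 0 <= 2 * level n by rewrite mulr_ge0// ltW.
apply: le_trans (expR_ge1Dxn 3 L20).
have -> : 4`!%:R = 24 :> R by [].
have := level_geS n; have := level100 n.
move: L0; set L := level n => L0 L100 LS.
apply: (@le_trans _ _ (8 * L * L ^+ 2)).
  by rewrite ler_wpM2r ?sqr_ge0// ler_wpM2l.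
rewrite -[8 * L * L ^+ 2]addr0 [_ + 0]addrC lerD//.
have -> : (2 * L) ^+ 4 / 24 = (2 / 3 * L) * L * L ^+ 2 by field.
rewrite ler_wpM2r ?sqr_ge0// ler_wpM2r ?(ltW L0)//; lra.
Qed.

(** The factor 6 separates the windows [rho^2 / 8 < q < 4 rho^2], because [6^2] exceeds the ratio 32
    of their ends. The quotient of consecutive scales is at most [2 exp (- M)]. *)
Lemma rho_decr m n : (m < n)%N -> 6 * rho n <= rho m.
Proof.
have S n' : 6 * rho n'.+1 <= rho n'.
  have L0 := level_gt0 n'; have l0 := lam_gt0 n'; have Lg := level_ge n'.
  rewrite /rho /lam levelS expRD invfM !mulrA.
  rewrite ler_pdivrMr ?expR_gt0// [_ / _ * expR _]mulrAC.
  rewrite ler_pM2r ?invr_gt0 ?expR_gt0//.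
  have eM := expR_ge1Dx (M%:R : R).
  have : 12 <= expR (M%:R : R) by have := M_ge; have := dA0; have := A0; lra.
  by nra.
elim: n => // n IH; rewrite ltnS leq_eqVlt => /predU1P[->//|/IH mn].
have r0 := rho_gt0 n.
by apply: le_trans (S n) _; apply: le_trans mn; lra.
Qed.

(** This is [|ln r|^2 / r^2] written in [q = r^2], where [ln q = 2 ln r]. *)
Definition base q : R := ln q ^+ 2 / (4 * q).

Lemma base_ge0 q : 0 <= q -> 0 <= base q.
Proof. by move=> q0; rewrite divr_ge0 ?sqr_ge0// mulr_ge0. Qed.

Let window_pos n q : 1 / 8 < q / rho n ^+ 2 < 4 ->
  rho n ^+ 2 / 8 < q < 4 * rho n ^+ 2.
Proof.
move=> /andP[]; rewrite ltr_pdivlMr ?sqr_rho_gt0// ltr_pdivrMr ?sqr_rho_gt0//.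
by move=> *; lra.
Qed.

(** With [y = q / rho^2], [- ln q = 2 L - 2 ln L - ln y] lies between [L] and [3 L], so
    [4 y * base q] lies between [lam^2] and [9 lam^2]; the constants follow from
    [1 / 2 < 4 y < 16]. *)
Lemma base_window n q : 1 / 8 < q / rho n ^+ 2 < 4 ->
  lam n ^+ 2 <= 16 * base q /\ base q <= 18 * lam n ^+ 2.
Proof.
set y := q / _ => /andP[y1 y2].
have L0 := level_gt0 n; have l0 := lam_gt0 n; have r0 := rho_gt0 n.
have L100 := level100 n.
have y0 : 0 < y by lra.
have qE : q = y * rho n ^+ 2 by rewrite divfK// gt_eqF// exprn_gt0.
have q0 : 0 < q by rewrite qE mulr_gt0// exprn_gt0.
have lny : ln y < 4 by apply: lt_trans y2; exact: ln_sublinear.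
have lnyV : - 8 < ln y.
  have : ln y^-1 < y^-1 by apply: ln_sublinear; rewrite invr_gt0.
  rewrite lnV ?posrE// => H.
  have : y^-1 < 8 by rewrite invf_plt ?posrE//; lra.
  by lra.
have lnL : ln (level n) <= level n / 4.
  rewrite -ler_expR lnK ?posrE//.
  have L4 : 0 <= level n / 4 by lra.
  by apply: le_trans (expR_ge1Dxn 1 L4); rewrite (_ : 2`!%:R = 2 :> R)//; nra.
have lnL0 : 0 <= ln (level n) by rewrite ln_ge0//; lra.
have lnq : ln q = ln y + 2 * (ln (level n) - level n).
  rewrite qE lnM ?posrE ?exprn_gt0// lnXn// /rho ln_div ?posrE// ln_lam.
  by rewrite mulr_natl.
have lnq1 : level n <= - ln q by lra.
have lnq2 : - ln q <= 3 * level n by lra.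
have Bq : base q * (4 * y) = (ln q) ^+ 2 / level n ^+ 2 * lam n ^+ 2.
  have alg (l m b z : R) : l != 0 -> m != 0 -> z != 0 ->
      b / (4 * (z * (l / m) ^+ 2)) * (4 * z) = b / l ^+ 2 * m ^+ 2.
    by move=> l1 m1 z1; field; rewrite l1 m1 z1.
  by rewrite /base {2}qE; apply: alg; rewrite gt_eqF.
have s1 : 1 <= ln q ^+ 2 / level n ^+ 2.
  rewrite ler_pdivlMr ?exprn_gt0// mul1r -[leRHS]sqrrN.
  by rewrite ler_sqr ?nnegrE//; lra.
have s2 : ln q ^+ 2 / level n ^+ 2 <= 9.
  rewrite ler_pdivrMr ?exprn_gt0// -[leLHS]sqrrN.
  have -> : 9 * level n ^+ 2 = (3 * level n) ^+ 2 by ring.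
  by rewrite ler_sqr ?nnegrE//; lra.
have B0 := base_ge0 (ltW q0).
have l20 : 0 < lam n ^+ 2 by rewrite exprn_gt0.
split.
  apply: (@le_trans _ _ (base q * (4 * y))).
    by rewrite Bq ler_peMl// ltW.
  by rewrite mulrC ler_wpM2r//; lra.
apply: (@le_trans _ _ (2 * (base q * (4 * y)))).
  by rewrite mulrCA ler_peMr//; lra.
rewrite Bq (_ : 18 * lam n ^+ 2 = 2 * (9 * lam n ^+ 2)); last by rewrite mulrA -natrM.
by rewrite ler_wpM2l// ler_wpM2r// ltW.
Qed.

(** Here 576 is [16 * 36], where [36 = 4 * 3^2] bounds [y (y - 1)^2] on [(0, 4)]. *)
Definition well_bound : R := 2 + 576 * A ^+ 2.

Lemma well_potential_bounds n y : 0 < y < 4 ->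
  1 / 2 <= well_potential d A (level n) y <= well_bound.
Proof.
move=> /andP[y0 y4]; have L0 := level_gt0 n; have LM := level_ge n.
rewrite /well_potential /well_bound.
have A_ge0 := A0; have dA_ge0 := dA0; have Mg := M_ge.
set t := _ / level n.
have t1 : t <= 1 / 2.
  rewrite ler_pdivrMr// -!mulrA.
  have h1 : A * y <= A * 4 by rewrite ler_wpM2l// ltW.
  have h2 : d%:R * A * (y - 1) <= d%:R * A * 3 by rewrite ler_wpM2l//; lra.
  by rewrite !mulrA in h1 h2 *; lra.
have t2 : - (1 / 2) <= t.
  rewrite ler_pdivlMr// -!mulrA.
  have h1 : 0 <= A * y by rewrite mulr_ge0// ltW.
  have h2 : d%:R * A * (- 1) <= d%:R * A * (y - 1) by rewrite ler_wpM2l//; lra.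
  by rewrite !mulrA in h1 h2 *; lra.
have A20 : 0 <= A ^+ 2 by exact: sqr_ge0.
have g0 : 0 <= y * (y - 1) ^+ 2 by rewrite mulr_ge0 ?sqr_ge0// ltW.
have g1 : y * (y - 1) ^+ 2 <= 36.
  have : (y - 1) ^+ 2 <= 9 by nra.
  by have := sqr_ge0 (y - 1); nra.
have h0 : 0 <= A ^+ 2 * (y * (y - 1) ^+ 2) by rewrite mulr_ge0.
have h1 : A ^+ 2 * (y * (y - 1) ^+ 2) <= A ^+ 2 * 36 by rewrite ler_wpM2l.
have -> : 16 * A ^+ 2 * y * (y - 1) ^+ 2 = 16 * (A ^+ 2 * (y * (y - 1) ^+ 2)).
  by ring.
by apply/andP; split; lra.
Qed.

(** Its plateau [[1 / 4, 9 / 4]] is the support of [cutoff]: wherever a quasimode is nonzero, the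
    potential is exactly its well potential. *)
Definition window : R -> R := plateau (1 / 8) (1 / 4) (9 / 4) 4.

Lemma window_ge0 y : 0 <= window y.
Proof. exact: plateau_ge0. Qed.

Lemma window_le1 y : window y <= 1.
Proof. by rewrite plateau_le1//; lra. Qed.

Lemma window_eq0 y : ~~ (1 / 8 < y < 4) -> window y = 0.
Proof. by move=> H; rewrite /window plateau_eq0//; lra. Qed.

Lemma window_eq1 y : 1 / 4 <= y <= 9 / 4 -> window y = 1.
Proof. by move=> H; rewrite /window plateau_eq1//; lra. Qed.

(** Subtracting [base] inside makes [base + dip] the convex combination of [base] and the rescaled
    well potential with weight [window]. *)
Definition dip n q : R := window (q / rho n ^+ 2) *
  (lam n ^+ 2 * well_potential d A (level n) (q / rho n ^+ 2) - base q).

(* The dips are supported in [rho n ^+ 2 / 8 < q < 4 * rho n ^+ 2], where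
   [n < truncn q^-1]; the sum therefore runs over all dips active at [q]. *)
Definition vpot q : R :=
  sstep (1 / 2) (1 - q) * base q + \sum_(n < (Num.truncn q^-1).+1) dip n q.

Lemma dip_eq0 n q : ~~ (1 / 8 < q / rho n ^+ 2 < 4) -> dip n q = 0.
Proof. by move=> H; rewrite /dip window_eq0// mul0r. Qed.

Lemma active_uniq m n q : 1 / 8 < q / rho m ^+ 2 < 4 ->
  1 / 8 < q / rho n ^+ 2 < 4 -> m = n.
Proof.
have lem i j : (i < j)%N -> 1 / 8 < q / rho i ^+ 2 < 4 ->
    1 / 8 < q / rho j ^+ 2 < 4 -> False.
  move=> /rho_decr ij /window_pos/andP[h1 _] /window_pos/andP[_ h2].
  by have := rho_gt0 i; have := rho_gt0 j; nra.
by move=> Hm Hn; case: (ltngtP m n) => // H; exfalso; apply: (lem _ _ H).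
Qed.

Lemma active_small n q : 1 / 8 < q / rho n ^+ 2 < 4 ->
  0 < q <= 1 / 2 /\ (n < (Num.truncn q^-1).+1)%N.
Proof.
move=> /window_pos/andP[h1 h2]; have r0 := sqr_rho_gt0 n.
have q0 : 0 < q by apply: lt_trans h1; rewrite divr_gt0.
have small := sqr_rho_small n.
have n1 : 1 <= n.+1%:R :> R by rewrite ler1n.
split; first by apply/andP; split=> //; nra.
rewrite ltnS truncn_ge_nat ?invr_ge0 ?(ltW q0)//.
rewrite -[q^-1]mul1r ler_pdivlMr//.
apply: (@le_trans _ _ (n.+1%:R * (4 * rho n ^+ 2))); last by nra.
by rewrite ler_pM ?(ltW q0) ?(ltW h2)// ler_nat.
Qed.

Lemma vpot_active n q : 1 / 8 < q / rho n ^+ 2 < 4 ->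
  vpot q = base q + dip n q.
Proof.
move=> H; have [/andP[q0 q1] nq] := active_small H.
rewrite /vpot sstep_eq1; [|lra|lra].
rewrite mul1r (bigD1 (Ordinal nq))//= big1 ?addr0// => i ni.
apply: dip_eq0; apply: contraNN ni => Hi.
by apply/eqP/val_inj; exact: active_uniq Hi H.
Qed.

Lemma vpot_inactive q : (forall n, ~~ (1 / 8 < q / rho n ^+ 2 < 4)) ->
  vpot q = sstep (1 / 2) (1 - q) * base q.
Proof. by move=> H; rewrite /vpot big1 ?addr0// => n _; exact: dip_eq0. Qed.

Lemma vpot_well n q : 1 / 4 <= q / rho n ^+ 2 <= 9 / 4 ->
  vpot q = lam n ^+ 2 * well_potential d A (level n) (q / rho n ^+ 2).
Proof.
move=> H; rewrite (@vpot_active n); last by lra.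
by rewrite /dip window_eq1// mul1r addrC subrK.
Qed.

Lemma vpot_le q : 0 <= q -> vpot q <= (1 + 16 * well_bound) * base q.
Proof.
move=> q0; have B0 := base_ge0 q0.
have W0 : 0 <= well_bound by have := sqr_ge0 A; rewrite /well_bound; lra.
have [[n Hn]|H] := pselect (exists n, 1 / 8 < q / rho n ^+ 2 < 4).
  rewrite (vpot_active Hn) /dip; have [b1 b2] := base_window Hn.
  have /andP[_ e2] := @well_potential_bounds n (q / rho n ^+ 2) ltac:(lra).
  have w0 := window_ge0 (q / rho n ^+ 2); have w1 := window_le1 (q / rho n ^+ 2).
  move: e2 w0 w1; set X := well_potential _ _ _ _; set w := window _ => e2 w0 w1.
  have X2 : lam n ^+ 2 * X <= 16 * well_bound * base q.
    apply: (@le_trans _ _ (lam n ^+ 2 * well_bound)).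
      by rewrite ler_wpM2l// sqr_ge0.
    have -> : 16 * well_bound * base q = 16 * base q * well_bound by ring.
    by rewrite ler_wpM2r.
  have c0 : 0 <= 16 * well_bound * base q by apply: mulr_ge0 B0; apply: mulr_ge0 W0.
  rewrite mulrDl mul1r lerD2l; apply: (@le_trans _ _ (w * (16 * well_bound * base q))).
    by rewrite ler_wpM2l//; lra.
  by rewrite ler_piMl.
rewrite vpot_inactive => [|n]; last by apply/negP => ?; apply: H; exists n.
have := sstep_ge0 (1 / 2) (1 - q); have := @sstep_le1 _ (1 / 2 : R) (1 - q) ltac:(lra).
by nra.
Qed.

(** In a window both members of the convex combination dominate [base q / 36]: the well part is at
    least [lam^2 / 2] and [base q <= 18 lam^2]. For [q <= 1 / 2] the outer step is 1. *)
Lemma vpot_ge q : 0 <= q <= 1 / 2 -> base q / 36 <= vpot q.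
Proof.
move=> /andP[q0 q1]; have B0 := base_ge0 q0.
have [[n Hn]|H] := pselect (exists n, 1 / 8 < q / rho n ^+ 2 < 4).
  rewrite (vpot_active Hn) /dip; have [b1 b2] := base_window Hn.
  have /andP[e1 _] := @well_potential_bounds n (q / rho n ^+ 2) ltac:(lra).
  have w0 := window_ge0 (q / rho n ^+ 2); have w1 := window_le1 (q / rho n ^+ 2).
  move: e1 w0 w1; set X := well_potential _ _ _ _; set w := window _ => e1 w0 w1.
  have X1 : base q / 36 <= lam n ^+ 2 * X.
    apply: (@le_trans _ _ (lam n ^+ 2 * (1 / 2))); first by lra.
    by rewrite ler_wpM2l// sqr_ge0.
  move: X1; set Y := _ * X => X1.
  have h1 : w * (base q / 36) <= w * Y by rewrite ler_wpM2l.
  have h2 : (1 - w) * (base q / 36) <= (1 - w) * base q.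
    by apply: ler_wpM2l; lra.
  have := lerD h2 h1.
  have -> : (1 - w) * (base q / 36) + w * (base q / 36) = base q / 36 by field.
  by have -> : (1 - w) * base q + w * Y = base q + w * (Y - base q) by ring.
rewrite vpot_inactive => [|n]; last by apply/negP => ?; apply: H; exists n.
by rewrite sstep_eq1; lra.
Qed.

Lemma vpot_eq0 q : 1 <= q -> vpot q = 0.
Proof.
move=> q1; rewrite vpot_inactive => [|n]; last first.
  by apply/negP => /active_small[]; lra.
by rewrite sstep_eq0 ?mul0r//; lra.
Qed.

Lemma vpot_ge0 q : 0 <= q -> 0 <= vpot q.
Proof.
move=> q0; have B0 := base_ge0 q0; have [q1|q1] := leP q (1 / 2).
  by have := @vpot_ge q ltac:(lra); lra.
rewrite vpot_inactive => [|n]; first by rewrite mulr_ge0// sstep_ge0.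
by apply/negP => /active_small[]; lra.
Qed.

Lemma Csm_base : Csm [set q : R | 0 < q] base.
Proof.
have oP : open [set q : R | 0 < q] by exact: open_gt.
have C4 : Csm [set q : R | 0 < q] (fun q => 4 * q).
  exact: (CinfM oP (Cinf_cst _ _ 4) (Csm_id oP)).
have CV : Csm [set q : R | 0 < q] (fun q => (4 * q)^-1).
  apply: (Cinf_comp (D := [set x : R | x != 0]) oP _ Csm_inv C4) => q /= q0.
  by rewrite gt_eqF// mulr_gt0.
exact: (CinfM oP (CinfX 2 oP (Csm_ln (R := R))) CV).
Qed.

Lemma Csm_dip n : Csm [set q : R | 0 < q] (dip n).
Proof.
have oP : open [set q : R | 0 < q] by exact: open_gt.
have Cs : Csm [set q : R | 0 < q] (fun q => q / rho n ^+ 2).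
  exact: (CinfM oP (Csm_id oP) (Cinf_cst _ _ _)).
have CW : Csm [set q : R | 0 < q] (fun q => window (q / rho n ^+ 2)).
  by apply: (Cinf_comp oP _ (Csm_plateau _ _ _ _) Cs).
have CE : Csm [set q : R | 0 < q]
    (fun q => well_potential d A (level n) (q / rho n ^+ 2)).
  have C1 := CinfB oP Cs (Cinf_cst _ _ 1).
  exact: (CinfB oP (CinfD oP (Cinf_cst _ _ 1) (CinfM oP (CinfM oP
    (Cinf_cst _ _ (16 * A ^+ 2)) Cs) (CinfX 2 oP C1)))
    (CinfM oP (CinfD oP (CinfM oP (Cinf_cst _ _ (8 * A)) Cs)
      (CinfM oP (Cinf_cst _ _ (4 * d%:R * A)) C1)) (Cinf_cst _ _ _))).
exact: (CinfM oP CW (CinfB oP (CinfM oP (Cinf_cst _ _ _) CE) Csm_base)).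
Qed.

(** The number of summands in [vpot] depends on [q]; to the right of [q0] it can be frozen, as the
    added dips are inactive. *)
Lemma vpot_finite_sum q0 q : 0 < q0 < q ->
  vpot q = sstep (1 / 2) (1 - q) * base q +
    \sum_(n < (Num.truncn q0^-1).+1) dip n q.
Proof.
move=> /andP[q00 q0q]; have qp := lt_trans q00 q0q.
have mm : ((Num.truncn q^-1).+1 <= (Num.truncn q0^-1).+1)%N.
  rewrite ltnS truncn_ge_nat ?invr_ge0 ?(ltW q00)//.
  apply: (@le_trans _ _ q^-1); first by rewrite truncn_le invr_ge0 ltW.
  by rewrite lef_pV2 ?posrE// ltW.
rewrite /vpot -!(big_mkord xpredT (fun n => dip n q)); congr (_ + _).
rewrite [RHS](big_cat_nat (n := (Num.truncn q^-1).+1))//=.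
rewrite [X in _ = _ + X]big_nat [X in _ = _ + X]big1 ?addr0// => n /andP[n1 _].
apply: dip_eq0; apply/negP => /active_small[_].
by rewrite ltnNge n1.
Qed.

Lemma Csm_vpot : Csm [set q : R | 0 < q] vpot.
Proof.
have oP : open [set q : R | 0 < q] by exact: open_gt.
apply: Cinf_local => q /= q0.
have q20 : 0 < q / 2 by rewrite divr_gt0.
exists [set y | q / 2 < y]; split; [exact: open_gt|by rewrite /=; lra|].
have oU : open [set y | q / 2 < y] by exact: open_gt.
have sub : [set y : R | q / 2 < y] `<=` [set y | 0 < y].
  by move=> y /= /(lt_trans q20).
apply: (eq_Cinf oU (f := fun y => sstep (1 / 2) (1 - y) * base y +
    \sum_(n < (Num.truncn (q / 2)^-1).+1) dip n y)).
  by move=> y /= qy; apply/esym/vpot_finite_sum; rewrite q20.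
apply: (CinfD oU).
  apply: (CinfM oU); last exact: Cinf_subset Csm_base.
  apply: (Cinf_comp oU _ (Csm_sstep _)) => //.
  exact: (CinfB oU (Cinf_cst _ _ 1) (Csm_id oU)).
by apply: Cinf_sum => // n; apply: Cinf_subset (Csm_dip n).
Qed.

End potential.

(** * Annuli and balls *)

Section annulus.
Context {R : realType} {d : nat}.

(** A boundary point is the limit of interior points on its own ray, moved towards the middle
    radius. *)
Lemma closure_annulus (r1 r2 : R) : 0 < r1 -> r1 < r2 ->
  closure [set x : 'rV[R]_d | r1 < enorm x < r2] =
  [set x | r1 <= enorm x <= r2].
Proof.
move=> r10 r12; apply/seteqP; split.
  have cl : closed [set x : 'rV[R]_d | r1 <= enorm x <= r2].
    rewrite (_ : [set x | _] = (@enorm R d) @^-1` [set t | r1 <= t] `&`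
        (@enorm R d) @^-1` [set t | t <= r2]); last first.
      by apply/seteqP; split => x /=; [move/andP|move=> []; move=> -> ->].
    by apply: closedI; apply: closed_comp => [x _|];
      do ?[exact: continuous_enorm|exact: closed_ge|exact: closed_le].
  rewrite [X in _ `<=` X](proj1 (closure_id _) cl); apply: closure_subset.
  by move=> x /= /andP[/ltW -> /ltW ->].
move=> x /= /andP[x1 x2] B Bx.
have x0 : 0 < enorm x by apply: lt_le_trans x1.
pose r := (r1 + r2) / 2.
(* The norm of [p e] is [(1 - e) * enorm x + e * r], strictly between [r1] and [r2] for
   [0 < e <= 1]. *)
pose p (e : R) : 'rV[R]_d := (1 + e * ((r - enorm x) / enorm x)) *: x.
have cp : p e @[e --> (0 : R)^'+] --> x.
  have p0 : x = (1 + 0 * ((r - enorm x) / enorm x)) *: x.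
    by rewrite mul0r addr0 scale1r.
  rewrite [X in _ --> X]p0; apply: cvg_at_right_filter; apply: cvgZr_tmp.
  by apply: cvgD; [exact: cvg_cst|apply: cvgMr_tmp; exact: cvg_id].
have Bp : \forall e \near (0 : R)^'+, B (p e) by exact: cp.
near (0 : R)^'+ => e.
have e0 : 0 < e by near: e; exact: nbhs_right_gt.
have e1 : e <= 1 by near: e; exact: nbhs_right_le.
exists (p e); split; last by near: e.
rewrite /= /p enormZ ger0_norm.
  rewrite mulrDl mul1r -mulrA divfK ?gt_eqF// /r.
  by apply/andP; split; nra.
have -> : 1 + e * ((r - enorm x) / enorm x) = (1 - e) + e * (r / enorm x).
  by field; rewrite gt_eqF.
have r0 : 0 < r by rewrite /r; lra.
by rewrite addr_ge0 ?subr_ge0// mulr_ge0 ?ltW// divr_gt0.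
Unshelve. all: by end_near. Qed.

Lemma compact_ball : compact [set x : 'rV[R]_d | sqnorm x <= 1].
Proof.
apply: (@subclosed_compact _ _
  [set v : 'rV[R]_d | forall i, [set` `[-1, 1]] (v ord0 i)]).
- apply: (@closed_comp _ _ (@sqnorm R d) [set t | t <= 1]) => [x _|].
    exact: continuous_sqnorm.
  exact: closed_le.
- by apply: (@rV_compact R d (fun=> [set` `[-1, 1]])) => i; exact: segment_compact.
- move=> x /= x1 i; rewrite in_itv /=.
  have : x ord0 i ^+ 2 <= 1.
    apply: le_trans x1; rewrite /sqnorm (bigD1 i)//= lerDl.
    by apply: sumr_ge0 => j _; exact: sqr_ge0.
  by nra.
Qed.

End annulus.

(** * Quasimodes *)

Section quasimodes.
Context {R : realType} (d a M : nat).
Hypothesis M_large : (100 + 64 * a + 24 * (d * a) <= M)%N.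
Hypothesis d_gt0 : (0 < d)%N.

Local Notation A := (a%:R : R).
Local Notation L := (@level R M).
Local Notation lam := (@lam R M).
Local Notation rho := (@rho R M).

Let r_gt0 n : 0 < rho n := rho_gt0 M_large n.
Let L_ge1 n : 1 <= L n := level_ge1 M_large n.
Let sr_gt0 n : 0 < rho n ^+ 2 := sqr_rho_gt0 M_large n.

(** The reciprocal of the cube volume [(w / 16) ^+ d] for [w = rho / sqrt d], without its power of
    [rho]. *)
Definition amp_bound : R := (16 * Num.sqrt d%:R) ^+ d.

Lemma amplitude_exists n : exists Amp : R, [/\ 0 < Amp,
  Amp <= amp_bound * (rho n)^-1 ^+ d * expR (L n * (A / 16)) &
  normL 1 ((fun q => Amp * profile A (L n) ((rho n ^+ 2)^-1 * q)) \o @sqnorm R d)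
    = 1%E].
Proof.
have r0 := r_gt0 n; have sr0 := sr_gt0 n; have L1 := L_ge1 n.
have L0 : 0 <= L n by rewrite (le_trans _ L1).
have sd0 : 0 < Num.sqrt d%:R :> R by rewrite sqrtr_gt0 ltr0n.
pose G q := profile A (L n) ((rho n ^+ 2)^-1 * q).
(* The point with all coordinates [w] lies on the sphere of radius [rho n]. *)
pose w := rho n / Num.sqrt d%:R.
(* The least value of the Gaussian for [1 <= q <= 5 / 4], where [(q - 1)^2 <= 1 / 16]. *)
pose m := expR (- (L n * (A / 16))).
have w0 : 0 < w by rewrite divr_gt0.
have cG : continuous G.
  move=> q; apply: (@continuous_comp _ _ _ (fun q => (rho n ^+ 2)^-1 * q)).
    exact: mulrl_continuous.
  exact: (Cinf_continuous (Csm_profile A (L n))).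
have G01 q : 0 <= G q <= 1 by rewrite profile_ge0 profile_le1.
have wd : w ^+ 2 *+ d = rho n ^+ 2.
  by rewrite expr_div_n sqr_sqrtr// -mulr_natr divfK// pnatr_eq0 -lt0n.
have Gout q : 4 * rho n ^+ 2 <= q -> G q = 0.
  move=> Hq; rewrite /G /profile cutoff_eq0 ?mul0r//.
  have : 4 <= (rho n ^+ 2)^-1 * q by rewrite mulrC ler_pdivlMr.
  by lra.
have Gin q : rho n ^+ 2 <= q <= 5 / 4 * rho n ^+ 2 -> m <= G q.
  move=> /andP[h1 h2].
  have y1 : 1 <= (rho n ^+ 2)^-1 * q by rewrite mulrC ler_pdivlMr// mul1r.
  have y2 : (rho n ^+ 2)^-1 * q <= 5 / 4 by rewrite mulrC ler_pdivrMr.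
  rewrite /G /profile cutoff_eq1; last by lra.
  rewrite mul1r ler_expR lerN2 ler_wpM2l// ler_wpM2l//.
  by rewrite mulrC in y1 y2 *; nra.
have m0 : 0 < m by exact: expR_gt0.
have [I IE Ige] := normL1_radial_bounds cG G01 r0 w0 wd Gout Gin (ltW m0).
have mw0 : 0 < m * (w / 16) ^+ d by rewrite mulr_gt0// exprn_gt0// divr_gt0.
have I0 : 0 < I by exact: lt_le_trans Ige.
exists I^-1; split; first by rewrite invr_gt0.
  apply: (@le_trans _ _ (m * (w / 16) ^+ d)^-1); first by rewrite lef_pV2.
  rewrite invfM /m -expRN opprK mulrC /amp_bound -exprMn -exprVn.
  rewrite le_eqVlt; apply/orP; left; apply/eqP; congr (_ ^+ _ * _).
  by rewrite /w invfM invf_div invrK [LHS]mulrC mulrA.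
rewrite (normL1_radialZ cG) => [|q|]; last by rewrite invr_ge0 ltW.
  by rewrite IE -EFinM mulVf// gt_eqF.
by have /andP[] := G01 q.
Qed.

Definition quasimode (Amp : nat -> R) n (x : 'rV[R]_d) : R :=
  ((fun q => Amp n * profile A (L n) ((rho n ^+ 2)^-1 * q)) \o @sqnorm R d) x.

Definition potential (x : 'rV[R]_d) : R := vpot d a M (sqnorm x).

Variables (Amp : nat -> R) (n : nat).
Hypothesis Amp_gt0 : 0 < Amp n.

Let F q := Amp n * profile A (L n) ((rho n ^+ 2)^-1 * q).

Let Csm_F : Csm setT F.
Proof.
have oT := @openT R; apply: (CinfM oT (Cinf_cst _ _ _)).
apply: (Cinf_comp oT _ (Csm_profile A (L n))) => //.
exact: (CinfM oT (Cinf_cst _ _ _) (Csm_id oT)).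
Qed.

Lemma quasimode_radial : radial (quasimode Amp n).
Proof. exact: (@radial_sqnorm R d F). Qed.

Lemma quasimode_smooth : smooth_on setT (quasimode Amp n).
Proof.
apply: smooth_on_Cinf; apply: (Cinf_radial _ _ Csm_F) => //; exact: openT.
Qed.

Lemma quasimode_support : tsupport (quasimode Amp n) =
  [set x | 1 / 2 * rho n <= enorm x <= 3 / 2 * rho n].
Proof.
have r0 := r_gt0 n; have sr0 := sr_gt0 n.
rewrite /tsupport -closure_annulus; [|by lra|by lra].
congr closure; apply/seteqP; split => x /=;
  rewrite /quasimode /= mulf_eq0 (gt_eqF Amp_gt0) /= /profile mulf_eq0;
  rewrite (gt_eqF (expR_gt0 _)) orbF -sqr_enorm; have x0 := enorm_ge0 x.
  move=> c0; have : 0 < cutoff ((rho n ^+ 2)^-1 * enorm x ^+ 2).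
    by rewrite lt_def c0 cutoff_ge0.
  rewrite cutoff_gt0 [_^-1 * enorm x ^+ 2]mulrC ltr_pdivlMr// ltr_pdivrMr//.
  move=> /andP[h1 h2].
  by apply/andP; split; nra.
move=> /andP[h1 h2]; rewrite gt_eqF// cutoff_gt0 [_^-1 * enorm x ^+ 2]mulrC.
by rewrite ltr_pdivlMr// ltr_pdivrMr//; apply/andP; split; nra.
Qed.

(** Since [lam^2 = L^2 / rho^2], the undifferentiated cutoff terms of the Laplacian cancel against
    [V - lam^2], and only derivatives of the cutoff remain. *)
Lemma quasimode_equation (x : 'rV[R]_d) :
  (- laplacian (quasimode Amp n) x + potential x * quasimode Amp n x)
    - lam n ^+ 2 * quasimode Amp n x =
  Amp n * (rho n ^+ 2)^-1 * source d A (L n) ((rho n)^-1 * enorm x).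
Proof.
have r0 := r_gt0 n; have sr0 := sr_gt0 n; have L1 := L_ge1 n.
have L0 : L n != 0 by rewrite gt_eqF// (lt_le_trans _ L1).
have CP := Csm_profile A (L n).
rewrite -[quasimode Amp n]/(F \o @sqnorm R d) laplacian_radial//.
set q := sqnorm x; pose k := (rho n ^+ 2)^-1; pose y := k * q.
have D1 : 'D_(1 : R) F q = Amp n * k * 'D_(1 : R) (profile A (L n)) y.
  by have := congr1 (@^~ q) (nderive_scale 1 (Amp n) k CP); rewrite expr1.
have D2 : 'D_(1 : R) ('D_(1 : R) F) q =
    Amp n * k ^+ 2 * 'D_(1 : R) ('D_(1 : R) (profile A (L n))) y.
  by have := congr1 (@^~ q) (nderive_scale 2 (Amp n) k CP); exact.
have Lk : lam n ^+ 2 = k * L n ^+ 2.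
  by rewrite /k /rho expr_div_n invf_div divfK// expf_neq0.
(* Multiplied by the profile, the formula for the potential holds everywhere: the profile vanishes
   outside the plateau of the window. *)
have VE : (potential x - lam n ^+ 2) * profile A (L n) y =
    k * L n ^+ 2 * (well_potential d A (L n) y - 1) * profile A (L n) y.
  have [Hy|Hy] := boolP (1 / 4 < y < 9 / 4); last first.
    by rewrite /profile (cutoff_eq0 Hy) mul0r !mulr0.
  rewrite /potential (@vpot_well _ d a M M_large n); last first.
    have /andP[/ltW h1 /ltW h2] := Hy.
    by rewrite [sqnorm x / _]mulrC -/k -/y h1 h2.
  by rewrite [sqnorm x / _]mulrC -/k -/y -Lk; ring.
have PL := profile_laplacian d A y L0.
have sE : ((rho n)^-1 * enorm x) ^+ 2 = y by rewrite exprMn exprVn sqr_enorm.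
have FE : (F \o @sqnorm R d) x = Amp n * profile A (L n) y by [].
rewrite FE D1 D2 /source /source0 /source1 sE.
have qE : q * (Amp n * k ^+ 2 * 'D_(1 : R) ('D_(1 : R) (profile A (L n))) y) *+ 4 +
    Amp n * k * 'D_(1 : R) (profile A (L n)) y *+ (2 * d) =
    Amp n * k * (4 * y * 'D_(1 : R) ('D_(1 : R) (profile A (L n))) y +
      2 * d%:R * 'D_(1 : R) (profile A (L n)) y).
  rewrite -[_ *+ 4]mulr_natr -[_ *+ (2 * d)]mulr_natr natrM /y.
  by move: ('D_(1 : R) ('D_(1 : R) (profile A (L n))) _ : R)
           ('D_(1 : R) (profile A (L n)) _ : R) => h2 h1; ring.
have alg1 (Am X H v l2 Y : R) : (v - l2) * H = Y ->
    - X + v * (Am * H) - l2 * (Am * H) = - X + Am * Y by move=> <-; ring.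
rewrite (etrans qE (congr1 (fun z => Amp n * k * z) PL)).
have alg (Am kk s0 s1 e l X P : R) :
    - (Am * kk * ((s0 - l * s1) * e + l ^+ 2 * X * P)) + Am * (kk * l ^+ 2 * X * P)
    = Am * kk * (1 * ((- s0) * e) + l * (s1 * e)) by ring.
exact: etrans (alg1 _ _ _ _ _ _ VE) (alg _ _ _ _ _ _ _ _).
Qed.

Let g t := Amp n * (rho n ^+ 2)^-1 * source d A (L n) ((rho n)^-1 * t).

Let Csm_g : Csm setT g.
Proof.
have oT := @openT R; apply: (CinfM oT (Cinf_cst _ _ _)).
apply: (Cinf_comp oT _ (Csm_source d A (L n))) => //.
exact: (CinfM oT (Cinf_cst _ _ _) (Csm_id oT)).
Qed.

(** Two powers of [1 / rho] come from the Laplacian, one from each radial derivative. *)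
Lemma quasimode_error_le (f : 'rV[R]_d -> R) j C :
  (forall x, f x =
    Amp n * (rho n ^+ 2)^-1 * source d A (L n) ((rho n)^-1 * enorm x)) ->
  (forall s, `|nderive j (source d A (L n)) s| <= C) ->
  (normL +oo (iter j radial_deriv f) <=
    (Amp n * (rho n)^-1 ^+ (j + 2) * C)%:E)%E.
Proof.
move=> fE HC; apply: normLy_le.
apply: (iter_radial_deriv_le Csm_g fE) => t.
have r0 := r_gt0 n.
rewrite (nderive_scale j _ _ (Csm_source d A (L n))) normrM.
have c0 : 0 <= Amp n * (rho n ^+ 2)^-1 * (rho n)^-1 ^+ j.
  by rewrite !mulr_ge0 ?exprn_ge0 ?invr_ge0 ?exprn_ge0 ?(ltW r0) ?(ltW Amp_gt0).
rewrite (ger0_norm c0) -exprVn -mulrA -exprD addnC ler_wpM2l//.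
by rewrite mulr_ge0 ?(ltW Amp_gt0)// exprn_ge0// invr_ge0 ltW.
Qed.

End quasimodes.

(** * The potential as a function on the whole space *)

Section potential_properties.
Context {R : realType} (d a M : nat).
Hypothesis M_large : (100 + 64 * a + 24 * (d * a) <= M)%N.
Local Notation V := (@potential R d a M).

Lemma potential_radial : radial V.
Proof. exact: (@radial_sqnorm R d (vpot d a M)). Qed.

Lemma potential_ge0 x : 0 <= V x.
Proof. by apply: vpot_ge0 => //; exact: sqnorm_ge0. Qed.

Lemma potential_compact_support : compact (tsupport V).
Proof.
apply: subclosed_compact (@compact_ball R d) _; first exact: closed_closure.
have cl : closed [set x : 'rV[R]_d | sqnorm x <= 1].
  apply: (@closed_comp _ _ (@sqnorm R d) [set t | t <= 1]) => [x _|].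
    exact: continuous_sqnorm.
  exact: closed_le.
rewrite [X in _ `<=` X](proj1 (closure_id _) cl); apply: closure_subset => x /=.
by apply: contra_neqT; rewrite -ltNge => /ltW; exact: vpot_eq0.
Qed.

Lemma potential_smooth : smooth_on [set x | x != 0] V.
Proof.
have E : [set x : 'rV[R]_d | x != 0] = @sqnorm R d @^-1` [set q | 0 < q].
  by apply/seteqP; split => x /=; rewrite sqnorm_gt0.
apply: smooth_on_Cinf; apply: (Cinf_radial _ _ (Csm_vpot M_large)).
  rewrite E; apply: open_comp => [x _|]; first exact: continuous_sqnorm.
  exact: open_gt.
by move=> x /=; rewrite sqnorm_gt0.
Qed.

Lemma potential_bounds : exists C r0 : R, [/\ 0 < C, 0 < r0 &
  forall x : 'rV[R]_d, 0 < enorm x <= r0 ->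
    `|ln (enorm x)| ^+ 2 / (C * enorm x ^+ 2) <= V x
      <= C * `|ln (enorm x)| ^+ 2 / enorm x ^+ 2].
Proof.
have W0 : 0 <= well_bound a :> R.
  by have := sqr_ge0 (a%:R : R); rewrite /well_bound; lra.
(* The constant dominates both 36 and [1 + 16 * well_bound a], and [r <= 1 / 2] gives
   [q <= 1 / 4]. *)
exists (36 + 16 * well_bound a), (1 / 2); split; [lra|lra|].
move=> x /andP[x0 x1].
have q0 : 0 <= sqnorm x by exact: sqnorm_ge0.
have q1 : 0 <= sqnorm x <= 1 / 2 by rewrite -sqr_enorm; nra.
have bE : base (sqnorm x) = `|ln (enorm x)| ^+ 2 / enorm x ^+ 2.
  rewrite /base -sqr_enorm lnXn// real_normK ?num_real//.
  by rewrite -mulr_natr; field; rewrite gt_eqF.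
have b0 := base_ge0 q0.
have h1 := vpot_ge M_large q1; have h2 := vpot_le M_large q0.
apply/andP; split; last first.
  rewrite -mulrA -bE; apply: le_trans h2 _; rewrite ler_wpM2r//; lra.
rewrite invfM [(_ + _)^-1 * _]mulrC mulrA -bE; apply: le_trans h1.
by rewrite ler_wpM2l// lef_pV2 ?posrE; lra.
Qed.

End potential_properties.

(** No logarithm is lost: [rho^-(d + j + 2)] carries [L^-(d + j + 2)], which absorbs [L^(j + 1)].
    What remains is [l] to the power [(d + j + 2) + k - 4 k], at most [j - N] since
    [3 k >= N + d + 2]. *)
Lemma scale_arithmetic (R : realType) (d N j : nat) (L l C D Am : R) :
  let k := (N + d + 2)%N in
  1 <= L -> l = expR L -> 0 <= C -> 0 <= D -> 0 <= Am ->
  Am <= D * (L / l)^-1 ^+ d * expR (L * ((16 * k)%:R / 16)) ->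
  Am * (L / l)^-1 ^+ (j + 2) * (C * L ^+ j.+1 * expR (- (L * ((16 * k)%:R / 4))))
    <= (C * D) * l ^ (j%:Z - N%:Z).
Proof.
move=> k L1 lE C0 D0 Am0 AmD.
have L0 : 0 < L by rewrite (lt_le_trans _ L1).
have l0 : 0 < l by rewrite lE expR_gt0.
have l1 : 1 <= l by rewrite lE -[1]expR0 ler_expR ltW.
have e1 : expR (L * ((16 * k)%:R / 16)) = l ^+ k.
  by rewrite lE -expRM_natl; congr expR; rewrite (natrM R 16 k); field.
have e2 : expR (- (L * ((16 * k)%:R / 4))) = (l ^+ (4 * k))^-1.
  rewrite lE expRN -expRM_natl; congr (expR _)^-1.
  by rewrite (natrM R 16 k) (natrM R 4 k); field.
have le_inv m : (L / l)^-1 ^+ m * L ^+ m = l ^+ m.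
  by rewrite -exprMn invf_div divfK// gt_eqF.
rewrite e2; rewrite e1 in AmD.
have i0 m : 0 <= (L / l)^-1 ^+ m by rewrite exprn_ge0// invr_ge0 divr_ge0// ltW.
apply: (@le_trans _ _ ((D * (L / l)^-1 ^+ d * l ^+ k) * (L / l)^-1 ^+ (j + 2) *
    (C * L ^+ j.+1 * (l ^+ (4 * k))^-1))).
  apply: ler_wpM2r; last by apply: ler_wpM2r.
  by rewrite !mulr_ge0// ?invr_ge0 exprn_ge0// ltW.
apply: (@le_trans _ _ (C * D * (((L / l)^-1 ^+ (d + (j + 2)) * L ^+ (d + (j + 2))) *
   (l ^+ k * (l ^+ (4 * k))^-1)))).
  have -> : D * (L / l)^-1 ^+ d * l ^+ k * (L / l)^-1 ^+ (j + 2) *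
      (C * L ^+ j.+1 * (l ^+ (4 * k))^-1) =
      C * D * (((L / l)^-1 ^+ (d + (j + 2)) * L ^+ j.+1) *
       (l ^+ k * (l ^+ (4 * k))^-1)) by rewrite (exprD _ d); ring.
  apply: ler_wpM2l; first exact: mulr_ge0.
  apply: ler_wpM2r.
    by rewrite mulr_ge0// ?invr_ge0 exprn_ge0// ltW.
  by apply: ler_wpM2l => //; rewrite ler_weXn2l//; lia.
rewrite le_inv; apply: ler_wpM2l; first exact: mulr_ge0.
have -> : l ^ (j%:Z - N%:Z) = l ^+ j * (l ^+ N)^-1.
  by rewrite expfzDr ?gt_eqF// -exprnP exprnN.
rewrite mulrA -exprD ler_pdivrMr ?exprn_gt0// mulrAC ler_pdivlMr ?exprn_gt0//.
by rewrite -!exprD ler_weXn2l//; rewrite /k; lia.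
Qed.

Unset Implicit Arguments.
Set Strict Implicit.

Theorem theorem1 (R : realType) (d N : nat) (d_ge1 : (1 <= d)%N) :
  exists (V : 'rV[R]_d -> R) (n0 : nat) (lambda : nat -> R)
         (u : nat -> 'rV[R]_d -> R),
  [/\ (* (i) *)
      [/\ radial V,
          forall x, 0 <= V x,
          compact (tsupport V),
          smooth_on [set x | x != 0] V &
          exists C r0 : R, [/\ 0 < C, 0 < r0 &
            forall x, 0 < enorm x <= r0 ->
              `|ln (enorm x)| ^+ 2 / (C * enorm x ^+ 2) <= V x
                <= C * `|ln (enorm x)| ^+ 2 / enorm x ^+ 2]],
      (* (ii) *)
      [/\ forall n, (n0 <= n)%N -> 0 < lambda n,
          forall m n, (n0 <= m)%N -> (m < n)%N -> lambda m < lambda n &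
          lambda n @[n --> \oo] --> +oo],
      (* (iii) *)
      [/\ forall n, (n0 <= n)%N -> radial (u n),
          forall n, (n0 <= n)%N -> smooth_on setT (u n) &
          exists c1 c2 : R, [/\ 0 < c1, c1 < c2 &
            forall n, (n0 <= n)%N ->
              tsupport (u n) =
              [set x | c1 * (ln (lambda n) / lambda n) <= enorm x
                         <= c2 * (ln (lambda n) / lambda n)]]] &
      let f n x :=
        (- laplacian (u n) x + V x * u n x) - lambda n ^+ 2 * u n x in
      (forall n, (n0 <= n)%N -> normL 1%E (u n) = 1%E) /\
      forall j : nat, exists C : R, \forall n \near \oo,
        (normL +oo%E (iter j radial_deriv (f n))
           <= (C * lambda n ^ (j%:Z - N%:Z))%:E)%E].
Proof.
(* The factor 16 makes both exponents [a / 16 = k] and [a / 4 = 4 k] integers. *)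
pose k := (N + d + 2)%N; pose a := (16 * k)%N.
pose M := (100 + 64 * a + 24 * (d * a))%N.
have M_large : (100 + 64 * a + 24 * (d * a) <= M)%N by [].
have [Amp AmpP] := choice (@amplitude_exists R d a M M_large d_ge1).
have Amp_gt0 n : 0 < Amp n by have [] := AmpP n.
exists (@potential R d a M), 0%N, (@lam R M), (@quasimode R d a M Amp); split.
- split.
  + exact: potential_radial.
  + exact: potential_ge0.
  + exact: potential_compact_support.
  + exact: potential_smooth.
  + exact: potential_bounds.
- split.
  + by move=> n _; exact: lam_gt0.
  + by move=> m n _; exact: (lam_incr M_large).
  + exact: (lam_cvg M_large).
- split.
  + by move=> n _; exact: quasimode_radial.
  + by move=> n _; exact: quasimode_smooth.
  + exists (1 / 2), (3 / 2); split; [lra|lra|] => n _.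
    rewrite (quasimode_support M_large) //.
    by rewrite ln_lam.
- split=> [n _|j]; first by have [_ _] := AmpP n.
  (* The constant is fixed before [n], being uniform in [L >= 1]; the estimate then holds for every
     [n]. *)
  have [C C0 HC] := @nderive_source_le R d a%:R j (ler0n _ _).
  exists (C * amp_bound d); apply: nearW => n.
  have L1 : 1 <= @level R M n := level_ge1 M_large n.
  have fE := @quasimode_equation R d a M M_large Amp n.
  apply: le_trans (quasimode_error_le M_large (Amp_gt0 n) (j := j) fE (HC _ L1)) _.
  rewrite lee_fin; have [_ Amp_le _] := AmpP n.
  apply: scale_arithmetic => //; last exact: ltW.
  by rewrite exprn_ge0// mulr_ge0// sqrtr_ge0.
Qed.
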